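(* Let $A\in\mathbf{RM}_4$ be a reciprocal $4\times4$ matrix with associated parameters $\xi_1,\xi_2,\xi_3\ge0$, and let $\phi=(\sqrt5+1)/2$. (a) If $\xi_2=\phi\xi_1-\phi^{-1}\xi_3$ or $\xi_2=\phi\xi_3-\phi^{-1}\xi_1$, then the rank-2 numerical range $\Lambda_2(A)$ is the elliptical disk bounded by the ellipse $E_2$ with foci $\pm\phi^{-1}$ and minor half-axis of length $\sqrt{\xi_3}\,\phi^{-1}$ in the first case, $\sqrt{\xi_1}\,\phi^{-1}$ in the second case ($E_2$ is the inner one of the two concentric ellipses constituting $C(A)$). (b) If $\xi_2=0$ and $\xi_1=\xi_3\neq0$, then $\Lambda_2(A)$ is the intersection of the two elliptical disks bounded by $E_1$ and $E_2$, where $E_1$ is the ellipse with foci $\phi,-\phi^{-1}$, $E_2$ is the ellipse with foci $-\phi,\phi^{-1}$, and both have minor half-axis of length $\sqrt{\xi_1}$ (these are the two ellipses constituting $C(A)$).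
   Context: A matrix $A=(a_{ij})\in M_n(\mathbb C)$ is reciprocal, $A\in\mathbf{RM}_n$, if it is tridiagonal with zero main diagonal ($a_{ij}=0$ whenever $|i-j|\neq1$) and $a_{i,i+1}a_{i+1,i}=1$ for $i=1,\dots,n-1$. Its parameters are $\xi_j=\frac14(|a_{j,j+1}|-|a_{j+1,j}|)^2\ge 0$, $j=1,\dots,n-1$. The rank-$k$ numerical range of $A\in M_n(\mathbb C)$ is $\Lambda_k(A)=\{\lambda\in\mathbb C: PAP=\lambda P\text{ for some rank-}k\text{ orthogonal projection }P\}$. The Kippenhahn curve $C(A)$ is the envelope of the lines $\ell_j(\theta)=e^{-i\theta}(\lambda_j(\theta)+i\mathbb R)$, $\theta\in[0,2\pi)$, $j=1,\dots,n$, where $\lambda_1(\theta)\ge\dots\ge\lambda_n(\theta)$ are the eigenvalues of $\operatorname{Re}(e^{i\theta}A)=\frac12(e^{i\theta}A+e^{-i\theta}A^* )$. An ellipse with minor axis of length zero is degenerate, and the elliptical disk it bounds is the line segment joining its foci. *)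

(* Defs.v *)
From HB Require Import structures.
From mathcomp Require Import all_boot all_order all_algebra.
From mathcomp Require Import complex.
From mathcomp Require Import all_classical all_reals all_analysis.

Set Implicit Arguments.
Unset Strict Implicit.
Unset Printing Implicit Defensive.

Import Order.TTheory GRing.Theory Num.Theory.
Import numFieldNormedType.Exports.

Local Open Scope ring_scope.
Local Open Scope classical_set_scope.
Local Open Scope complex_scope.
Local Open Scope sesquilinear_scope.

Definition cmod (R : realType) (z : R[i]) : R := ComplexField.Normc.normc z.

Definition expi (R : realType) (t : R) : R[i] := cos t +i* sin t.

(* For j : 'I_n, [jl j] and [jr j] are the positions j and j+1 in 'I_n.+1. *)
Definition jl n (j : 'I_n) : 'I_n.+1 := widen_ord (leqnSn n) j.
Definition jr n (j : 'I_n) : 'I_n.+1 := lift ord0 j.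

Definition reciprocal (R : realType) n (A : 'M[R[i]]_n.+1) : Prop :=
  (forall i j : 'I_n.+1, j != i.+1 :> nat -> i != j.+1 :> nat -> A i j = 0) /\
  (forall j : 'I_n, A (jl j) (jr j) * A (jr j) (jl j) = 1).

(* Zero-based: [xi A j] is the parameter usually numbered j+1. *)
Definition xi (R : realType) n (A : 'M[R[i]]_n.+1) (j : 'I_n) : R :=
  (cmod (A (jl j) (jr j)) - cmod (A (jr j) (jl j))) ^+ 2 / 4.

Definition orthogonal_projection (R : realType) n (P : 'M[R[i]]_n) : Prop :=
  P *m P = P /\ P^t* = P.

Definition rank_numerical_range (R : realType) (k n : nat) (A : 'M[R[i]]_n) :
    set R[i] :=
  [set l | exists P : 'M[R[i]]_n,
     [/\ orthogonal_projection P, \rank P = k & P *m A *m P = l *: P]].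

(* Re(e^{it} A) *)
Definition rotated_re (R : realType) n (A : 'M[R[i]]_n) (t : R) : 'M[R[i]]_n :=
  2^-1 *: (expi t *: A + expi (- t) *: A^t*).

(* The line e^{-it} (l + iR) has equation line_eqn z t l = 0. *)
Definition line_eqn (R : realType) (z : R[i]) (t l : R) : R :=
  complex.Re (expi t * z) - l.

(* Envelope of the lines e^{-it} (l + iR), l an eigenvalue of Re(e^{it} A):
   with F(z, t) = 0 the equation of a family of lines that depends
   differentiably on t, the envelope is given by F = 0 and dF/dt = 0.  The
   eigenvalues in decreasing order need not be differentiable in t where they
   cross, so the families are the differentiable selections [mu] of
   eigenvalues. *)
Definition kippenhahn_curve (R : realType) n (A : 'M[R[i]]_n) : set R[i] :=
  [set z | exists mu : R -> R,
     [/\ forall t, eigenvalue (rotated_re A t) (mu t)%:C,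
         forall t, derivable mu t 1 &
         exists t, line_eqn z t (mu t) = 0 /\
           is_derive t (1 : R) (fun s => line_eqn z s (mu s)) 0]].

(* Length of the major half-axis, from the foci and the minor half-axis. *)
Definition major_half_axis (R : realType) (f1 f2 : R[i]) (b : R) : R :=
  Num.sqrt (b ^+ 2 + (cmod (f1 - f2) / 2) ^+ 2).

(* The tangent lines of the degenerate ellipse b = 0 are the lines through one
   of its foci; as an envelope of lines this curve is the pair of foci.  The
   segment joining them is the disk, see [elliptical_disk]. *)
Definition ellipse (R : realType) (f1 f2 : R[i]) (b : R) : set R[i] :=
  [set z | if b == 0 then z = f1 \/ z = f2
           else cmod (z - f1) + cmod (z - f2) = 2 * major_half_axis f1 f2 b].

Definition elliptical_disk (R : realType) (f1 f2 : R[i]) (b : R) : set R[i] :=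
  [set z | cmod (z - f1) + cmod (z - f2) <= 2 * major_half_axis f1 f2 b].

(* The ellipse with foci f, -f and minor half-axis b is the inner one of two
   distinct ellipses centred at 0 whose union is the Kippenhahn curve of A. *)
Definition inner_component (R : realType) n (A : 'M[R[i]]_n)
    (f : R[i]) (b : R) : Prop :=
  exists (g : R[i]) (c : R),
    [/\ 0 <= c,
        kippenhahn_curve A = ellipse g (- g) c `|` ellipse f (- f) b &
        elliptical_disk f (- f) b `<` elliptical_disk g (- g) c].

Definition golden (R : realType) : R := (Num.sqrt 5 + 1) / 2.

(* Main.v *)
Require Import Defs.
From HB Require Import structures.
From mathcomp Require Import all_boot all_order all_algebra.
From mathcomp Require Import complex ring lra zify.
From mathcomp Require Import all_classical all_reals all_analysis.

(** For a reciprocal A of size 4 and |w| = 1, det (t - Re(w A)) depends only on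
    c = Re w and on the parameters xi_j.  Under each of the conditions of the
    theorem it is a product of two factors (t - m c)^2 - (f^2 c^2 + b^2), and
    such a factor vanishes at t when t is the support value in the direction w
    of the ellipse with foci m + f, m - f and minor half-axis b.  This gives the
    Kippenhahn curve.

    If X A X* = z for an isometry X of rank 2, then Re(w z) is at most the
    second largest eigenvalue of Re(w A), so z lies in both elliptical disks.
    Conversely, if z is strictly inside both disks, then Re(w (A - z)) is
    nonsingular for all |w| = 1; in other words, with M = A - z, no unimodular
    number is an eigenvalue of the pencil u M - M*, and two successive
    eigenvectors of such pencils span a 2-dimensional isotropic subspace of M.
    A point z of the closed disks is strictly inside the disks of a reciprocal
    matrix arbitrarily close to A, with all parameters (or xi_1 and xi_3 only)
    increased by the same amount, and membership in the rank-2 numerical range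
    passes to the limit by compactness of the set of isometries. *)

Set Implicit Arguments.
Unset Strict Implicit.
Unset Printing Implicit Defensive.

Import Order.TTheory GRing.Theory Num.Theory.
Import numFieldNormedType.Exports.

Local Open Scope ring_scope.
Local Open Scope classical_set_scope.
Local Open Scope complex_scope.

(** * Isotropic planes from pencils regular on the unit circle *)

Section isotropic.
Local Open Scope sesquilinear_scope.
Variable C : numClosedFieldType.

Lemma adjmxM m n p (A : 'M[C]_(m, n)) (B : 'M[C]_(n, p)) :
  (A *m B) ^t* = B^t* *m A^t*.
Proof. by rewrite trmx_mul map_mxM. Qed.

Lemma adjmx0 m n : (0 : 'M[C]_(m, n)) ^t* = 0.
Proof. by rewrite trmx0 map_mx0. Qed.

Lemma adjmx_eq0 m n (A : 'M[C]_(m, n)) : A^t* = 0 -> A = 0.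
Proof. by move=> A0; rewrite -[A]trmxCK A0 adjmx0. Qed.

(** A singular [M] has a left null vector, which serves. Otherwise take [x] with [x M^* = a x M]:
    conjugating [x M x^*] multiplies it by [a], and [|a| != 1] by regularity, so it vanishes. The
    last conclusion turns one-sided orthogonality to [x] into two-sided orthogonality, so that a
    second vector can be sought in the orthogonal of [x]. *)
Lemma isotropic_eigenvector n (M : 'M[C]_n) : (0 < n)%N ->
    (forall z u, `|z| = 1 -> u *m (z *: M - M^t* ) = 0 -> u = 0 :> 'rV_n) ->
  exists x : 'rV_n, [/\ x *m M *m x^t* = 0, M *m x^t* != 0 &
    forall m (y : 'M[C]_(m, n)), y *m M *m x^t* = 0 -> x *m M *m y^t* = 0].
Proof.
move=> n0 regM.
have [Mu|] := boolP (M \in unitmx); last first.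
  rewrite unitmxE unitfE negbK => /det0P[x x0 xM]; exists x.
  split=> [||m y _]; rewrite ?xM ?mul0mx//.
  apply: contra_neq x0 => Mx; apply: (regM 1); first by rewrite normr1.
  by rewrite scale1r mulmxBr xM -[x]trmxCK -adjmxM Mx adjmx0 subr0.
have [a /eigenvalueP[x xa x0]] := eigenvalue_closed (M^t* *m invmx M) n0.
have {}xa : x *m M^t* = a *: (x *m M).
  by rewrite scalemxAl -xa mulmxA mulmxKV.
have a1 : `|a| != 1.
  apply: contra_neq x0 => /regM; apply.
  by rewrite mulmxBr -scalemxAr xa subrr.
have Mx : M *m x^t* != 0.
  apply: contra_neq x0 => Mx; apply: adjmx_eq0.
  by rewrite -[x^t*](mulKmx Mu) Mx mulmx0.
have a0 : a != 0.
  apply: contra_neq Mx => a0; apply: adjmx_eq0.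
  by rewrite adjmxM trmxCK xa a0 scale0r.
have swap m (y : 'M[C]_(m, n)) : (y *m M *m x^t* ) ^t* = a *: (x *m M *m y^t* ).
  by rewrite !adjmxM trmxCK mulmxA xa -scalemxAl.
exists x; split=> // [|m y yM].
  have /matrixP/(_ 0 0) := swap _ x; rewrite !mxE.
  set q := \sum_j _ => /(congr1 Num.norm); rewrite norm_conjC normrM => /esym/eqP.
  rewrite -subr_eq0 -{2}[`|q|]mul1r -mulrBl mulf_eq0 subr_eq0 (negPf a1) /=.
  rewrite normr_eq0 => /eqP q0; apply/matrixP=> i j.
  by rewrite !ord1 mxE -/q q0 mxE.
have := swap _ y; rewrite yM adjmx0 => /esym/eqP.
by rewrite scaler_eq0 (negPf a0) => /eqP.
Qed.

(* The isotropic eigenvector x of the pencil z M - M* is split off: the pencil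
   stays regular on a complement of x in the M-orthogonal of x. *)
Lemma rank2_isotropic (M : 'M[C]_4) :
    (forall z : C, `|z| = 1 -> \det (z *: M - M^t* ) != 0) ->
  exists2 X : 'M[C]_(2, 4), X \is unitarymx & X *m M *m X^t* = 0.
Proof.
move=> detM.
have regM z (u : 'rV_4) : `|z| = 1 -> u *m (z *: M - M^t* ) = 0 -> u = 0.
  move=> z1 uN; apply/eqP; apply: contraT => u0.
  by have /negP[] := detM _ z1; apply/det0P; exists u.
have [x [xx Mx xsym]] := isotropic_eigenvector (isT : (0 < 4)%N) regM.
(* [W] is the 3-dimensional space of the [y] with [y M x^* = 0]. It contains [x], and [V] will be a
   complement of [x] in it. *)
pose W := kermx (M *m x^t* ).
have WMx : W *m M *m x^t* = 0 by rewrite -mulmxA mulmx_ker.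
have xMW : x *m M *m W^t* = 0 by exact: xsym.
have rW : \rank W = 3%N.
  rewrite mxrank_ker; suff -> : \rank (M *m x^t* ) = 1%N by [].
  by apply/eqP; rewrite eqn_leq rank_leq_col lt0n mxrank_eq0.
have x0 : x != 0 by apply: contra_neq Mx => ->; rewrite adjmx0 mulmx0.
have xW : (x <= W)%MS by apply/sub_kermxP; rewrite mulmxA.
pose V := (W :\: x)%MS.
have Vx : (V :&: x = 0)%MS by exact: capmx_diff.
have rV : \rank V = 2%N.
  have := mxrank_cap_compl W x; rewrite -/V (capmx_idPr xW) rW.
  by rewrite rank_rV x0 => -[].
have [U UV Ufree] : exists2 U : 'M[C]_(\rank V, 4), (U :=: V)%MS & row_free U.
  by exists (row_base V); [exact: eq_row_base|exact: row_base_free].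
have UW : (U <= W)%MS by rewrite UV diffmxSl.
have WxU : (W <= col_mx x U)%MS.
  by rewrite -addsmxE -(addsmx_diff_cap_eq W x) addsmxC addsmxS ?capmxSr ?UV.
have [D UE] := submxP UW.
have UMx : U *m M *m x^t* = 0 by rewrite UE -(mulmxA D W) -(mulmxA D) WMx mulmx0.
have xMU : x *m M *m U^t* = 0 by exact: xsym.
have [v vv v0] : exists2 v : 'rV_(\rank V),
    v *m (U *m M *m U^t* ) *m v^t* = 0 & v != 0.
  have V0 : (0 < \rank V)%N by rewrite rV.
  have [z v z1|v [vv Mv _]] := @isotropic_eigenvector _ (U *m M *m U^t* ) V0.
    set N := z *: M - M^t*; pose u := v *m U => vN.
    apply/eqP; apply: contraT => v0.
    have u0 : u != 0 by rewrite mulmx_free_eq0 ?row_base_free.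
    have uU : u *m N *m U^t* = 0.
      rewrite -vN /N /u !adjmxM !trmxCK !mulmxBr !mulmxBl -!scalemxAr -!scalemxAl.
      by rewrite !mulmxA.
    have uW : (u <= W)%MS by rewrite (submx_trans _ UW) ?submxMl.
    have orthox m (y : 'M[C]_(m, 4)) : y *m M *m x^t* = 0 -> y *m N *m x^t* = 0.
      move=> yx; rewrite /N mulmxBr mulmxBl -scalemxAr -scalemxAl yx scaler0.
      have := congr1 (fun Y => Y^t* ) (xsym _ _ yx).
      by rewrite !adjmxM adjmx0 trmxCK mulmxA => ->; rewrite subr0.
    have xN m (y : 'M[C]_(m, 4)) : x *m M *m y^t* = 0 -> y *m M *m x^t* = 0 ->
        x *m N *m y^t* = 0.
      move=> xy yx; rewrite /N mulmxBr mulmxBl -scalemxAr -scalemxAl xy scaler0.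
      have := congr1 (fun Y => Y^t* ) yx.
      by rewrite !adjmxM adjmx0 trmxCK mulmxA => ->; rewrite subr0.
    (* The plane spanned by [x] and [u] would be [N]-orthogonal to the 3-dimensional [W], which is
       impossible in dimension 4 for a nonsingular [N]. *)
    have PNW : col_mx x u *m N *m W^t* = 0.
      have [D' ->] := submxP WxU.
      rewrite adjmxM mulmxA (mul_col_mx x u N) tr_col_mx map_row_mx mul_col_row.
      rewrite !xN// uU orthox ?block_mx0 ?mul0mx//.
      by rewrite /u -!mulmxA (mulmxA U) UMx mulmx0.
    have := mulmx0_rank_max PNW; rewrite mxrank_map mxrank_tr rW.
    rewrite mxrankMfree; last by apply: inj_row_free => w; exact: regM.
    rewrite -addsmxE mxrank_disjoint_sum ?rank_rV ?x0 ?u0//.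
    apply/eqP; rewrite -submx0 -Vx capmxC capmxS// -UV.
    exact: submxMl.
  exists v => //; apply: contra_neq Mv => ->; by rewrite adjmx0 mulmx0.
pose X0 := col_mx x (v *m U).
have X0M : X0 *m M *m X0^t* = 0.
  rewrite /X0 (mul_col_mx x _ M) tr_col_mx map_row_mx mul_col_row.
  rewrite !adjmxM !mulmxA xx.
  rewrite xMU mul0mx -(mulmxA v U) -(mulmxA v) UMx mulmx0.
  by move: vv; rewrite !mulmxA => ->; rewrite block_mx0.
have X0free : row_free X0.
  rewrite /row_free -addsmxE mxrank_disjoint_sum.
    by rewrite !rank_rV x0 mulmx_free_eq0//; have -> : v != 0 by [].
  apply/eqP; rewrite -submx0 -Vx capmxC capmxS// -UV.
  exact: submxMl.
(* Isotropy depends only on the row space, which Gram-Schmidt preserves. *)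
exists (schmidt X0); first exact: schmidt_unitarymx.
have /submxP[D' ->] : (schmidt X0 <= X0)%MS by rewrite eqmx_schmidt_free.
by rewrite adjmxM mulmxA -(mulmxA D') -(mulmxA D') X0M mulmx0 mul0mx.
Qed.
End isotropic.

(** * Scalar compressions of Hermitian matrices *)

Section compression.
Local Open Scope sesquilinear_scope.
Variable C : numClosedFieldType.

(* A vector of the 2-dimensional range of X has no component along the only
   eigenvector whose eigenvalue may exceed rho. *)
Lemma hermitian_compression_le n (H : 'M[C]_n.+1) (r0 : C) (rs : seq C)
    (X : 'M[C]_(2, n.+1)) (rho t : C) :
    H^t* = H -> char_poly H = \prod_(a <- r0 :: rs) ('X - a%:P) ->
    all (<= rho) rs -> X \is unitarymx -> X *m H *m X^t* = t%:M ->
  t <= rho.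
Proof.
move=> Hherm Hchar rs_le /unitarymxP XX XHX.
have Hn : H \is normalmx by apply/normalmxP; rewrite Hherm.
have /orthomx_spectralP := Hn.
set U := spectralmx H; set d := spectral_diag H => HE.
have Uu : U \is unitarymx := spectral_unitarymx H.
rewrite invmx_unitary// in HE.
have UU : U^t* *m U = 1%:M.
  by rewrite -[U in _ *m U]trmxCK; apply/unitarymxP; rewrite trmxC_unitary.
have chard : char_poly H = \prod_(a <- [seq d ord0 i | i : 'I_n.+1]) ('X - a%:P).
  have -> : char_poly H = char_poly (diag_mx d).
    rewrite /char_poly /char_poly_mx.
    have -> : 'X%:M - map_mx polyC H = map_mx polyC (U^t* ) *m
        ('X%:M - map_mx polyC (diag_mx d)) *m map_mx polyC U.
      rewrite mulmxBr mulmxBl -!map_mxM -HE; congr (_ - _).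
      by rewrite mul_mx_scalar -scalemxAl -map_mxM UU map_mx1 scalemx1.
    rewrite !det_mulmx mulrAC -det_mulmx -map_mxM UU map_mx1 det1 mul1r.
    by [].
  rewrite char_poly_trig ?diag_mx_is_trig// big_image /=.
  by apply: eq_bigr => i _; rewrite mxE eqxx mulr1n.
have dperm : perm_eq [seq d ord0 i | i : 'I_n.+1] (r0 :: rs).
  by apply: prod_XsubC_eq; rewrite -chard.
(* Counted with multiplicity, only the eigenvalue matched with [r0] can fail to be at most [rho]. *)
have [i0 dle] : exists i0, forall i, i != i0 -> d ord0 i <= rho.
  have : (#|[pred i | ~~ (d ord0 i <= rho)%R]| <= 1)%N.
    pose P := [pred a | ~~ (a <= rho)].
    have -> : #|[pred i | ~~ (d ord0 i <= rho)%R]| =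
        count P [seq d ord0 i | i : 'I_n.+1].
      by rewrite count_map cardE size_filter enumT.
    have /allP rsle : all (<= rho) rs by [].
    rewrite (permP dperm) /= (_ : count P rs = 0%N) ?addn0 ?leq_b1//.
    apply/eqP; rewrite -leqn0 leqNgt -has_count; apply/hasPn => a /rsle /= ale.
    by rewrite negbK.
  move=> /card_le1_eqP cle.
  have [i0 di0|d0] := pickP [pred i | ~~ (d ord0 i <= rho)]; last first.
    by exists ord0 => i _; have /negbFE := d0 i.
  exists i0 => i; apply: contraNT => di; apply/eqP; exact: cle.
pose Y := X *m U^t*.
have YY : Y *m Y^t* = 1%:M.
  by rewrite /Y adjmxM trmxCK mulmxA -(mulmxA X) UU mulmx1.
have YDY : Y *m diag_mx d *m Y^t* = t%:M.
  by rewrite /Y adjmxM trmxCK -XHX HE !mulmxA.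
clearbody Y.
(* Column [i0] of [Y] has two entries, so a nonzero combination of the two rows of [Y] vanishes at
   [i0]. *)
have [v vY v0] : exists2 v : 'rV_2, v *m col i0 Y = 0 & v != 0.
  have : kermx (col i0 Y) != 0.
    by rewrite kermx_eq0 /row_free neq_ltn (leq_ltn_trans (rank_leq_col _)).
  by case/rowV0Pn => v /sub_kermxP; exists v.
have [y yvY] : exists y, y = v *m Y by exists (v *m Y).
have yi0 : y 0 i0 = 0.
  have /matrixP/(_ 0 0) := vY; rewrite [RHS]mxE mxE => vY0.
  rewrite yvY mxE -[RHS]vY0; apply: eq_bigr => k _.
  by rewrite [col _ _ _ _]mxE.
have yv : \sum_i `|y 0 i| ^+ 2 = (v *m v^t* ) 0 0.
  have <- : y *m y^t* = v *m v^t*.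
    by rewrite yvY adjmxM mulmxA -(mulmxA v) YY mulmx1.
  rewrite mxE.
  by apply: eq_bigr => i _; rewrite !mxE normCK.
have yE : \sum_i d ord0 i * `|y 0 i| ^+ 2 = t * \sum_i `|y 0 i| ^+ 2.
  have sumE D : (y *m diag_mx D *m y^t* ) 0 0 = \sum_i D 0 i * `|y 0 i| ^+ 2.
    rewrite mxE; apply: eq_bigr => i _.
    by rewrite mul_mx_diag !mxE normCK mulrA [_ * y 0 i]mulrC.
  rewrite yv.
  rewrite -sumE yvY adjmxM !mulmxA.
  rewrite -(mulmxA v Y) -(mulmxA v) YDY.
  by rewrite mul_mx_scalar -scalemxAl mxE.
have y_gt0 : 0 < \sum_i `|y 0 i| ^+ 2.
  rewrite yv lt_def -{2}yv sumr_ge0 ?andbT => [|i _]; last exact: exprn_ge0.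
  apply: contra_neq v0; rewrite mxE => vv; apply/rowP => i.
  have := @psumr_eq0P _ _ _ (fun k => v 0 k * v^t* k 0) _ vv i isT.
  rewrite !mxE -normCK => vi; apply/eqP; rewrite -normr_eq0 -sqrf_eq0 vi//.
  by move=> k _; rewrite !mxE -normCK exprn_ge0.
(* [rho - t] times the squared norm of [y] is the sum of the [(rho - d_i) |y_i|^2]; the one factor
   not known to be nonnegative meets [y_i = 0]. *)
rewrite -subr_ge0 -(pmulr_lge0 _ y_gt0) mulrBl -yE mulr_sumr -sumrB.
apply: sumr_ge0 => i _; rewrite -mulrBl.
have [->|ii0] := eqVneq i i0; first by rewrite yi0 normr0 expr0n mulr0.
by rewrite mulr_ge0 ?subr_ge0 ?dle ?exprn_ge0.
Qed.
End compression.

(** * Determinants of tridiagonal matrices of size 4 *)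

Lemma det_tridiagonal4 (R : comNzRingType) (M : 'M[R]_4) (d : R)
    (i0 := @Ordinal 4 0 isT) (i1 := @Ordinal 4 1 isT)
    (i2 := @Ordinal 4 2 isT) (i3 := @Ordinal 4 3 isT) :
    (forall i, M i i = d) ->
    (forall i j : 'I_4, (i.+1 < j)%N || (j.+1 < i)%N -> M i j = 0) ->
  \det M = d ^+ 4 - (M i0 i1 * M i1 i0 + M i1 i2 * M i2 i1 + M i2 i3 * M i3 i2)
    * d ^+ 2 + M i0 i1 * M i1 i0 * (M i2 i3 * M i3 i2).
Proof.
(* With natural numbers as indices, the row expansions end in literal entries [f i j], to which the
   vanishing equations apply by rewriting. *)
move=> Md M0; pose f i j := M (inord i) (inord j).
have fE (i j : 'I_4) : M i j = f i j by rewrite /f !inord_val.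
have -> : M = \matrix_(i, j) f i j by apply/matrixP=> i j; rewrite mxE fE.
have fd i : f i i = d by exact: Md.
have f0 i j : (i < 4)%N -> (j < 4)%N -> (i.+1 < j)%N || (j.+1 < i)%N -> f i j = 0.
  by move=> i4 j4 ij; apply: M0; rewrite !inordK.
have f02 : f 0%N 2%N = 0 by exact: f0.
have f03 : f 0%N 3%N = 0 by exact: f0.
have f13 : f 1%N 3%N = 0 by exact: f0.
have f20 : f 2%N 0%N = 0 by exact: f0.
have f30 : f 3%N 0%N = 0 by exact: f0.
have f31 : f 3%N 1%N = 0 by exact: f0.
clearbody f; clear f0 M0 Md fE.
do 4! rewrite ?(expand_det_row _ ord0) ?big_ord_recl ?big_ord0 /cofactor
  ?det_mx00 /= ?mxE /= /bump /= ?addn0 ?add0n ?addn1 ?add1n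
  ?f02 ?f03 ?f13 ?f20 ?f30 ?f31 ?mul0r ?add0r ?addr0.
rewrite !fd.
by rewrite ?mxE /=; ring.
Qed.


(** The ring is arbitrary so that [d] can be a complex number or the indeterminate of a
    characteristic polynomial. *)
Lemma det_scalar_sub_tridiagonal4 (R : comNzRingType) (H : 'M[R]_4) (d p1 p2 p3 : R)
    (i0 := @Ordinal 4 0 isT) (i1 := @Ordinal 4 1 isT)
    (i2 := @Ordinal 4 2 isT) (i3 := @Ordinal 4 3 isT) :
    (forall i, H i i = 0) ->
    (forall i j : 'I_4, (i.+1 < j)%N || (j.+1 < i)%N -> H i j = 0) ->
    H i0 i1 * H i1 i0 = p1 -> H i1 i2 * H i2 i1 = p2 ->
    H i2 i3 * H i3 i2 = p3 ->
  \det (d%:M - H) = d ^+ 4 - (p1 + p2 + p3) * d ^+ 2 + p1 * p3.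
Proof.
move=> Hd H0 <- <- <-; rewrite (det_tridiagonal4 (d := d)).
- rewrite !(mxE _ _ i0, mxE _ _ i1, mxE _ _ i2, mxE _ _ i3) /=.
  by rewrite !mulr0n !sub0r !mulrNN.
- by move=> i; rewrite !mxE Hd eqxx subr0.
- move=> i j ij; rewrite !mxE H0// (_ : (i == j) = false) ?subr0//.
  by apply/eqP => ijE; move: ij; rewrite ijE; lia.
Qed.

(** * Rank-k numerical range through isometries, and the matrices Re(w A) *)

Section numerical_range.
Local Open Scope sesquilinear_scope.
Variable R : realType.
Local Notation C := R[i].

(** The rows of [X] form an orthonormal basis of the row space of [P]: one direction uses [X P = X],
    the other takes [P = X^* X]. *)
Lemma rank_numerical_rangeP k n (A : 'M[C]_n) (z : C) :
  rank_numerical_range k A z <->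
  exists2 X : 'M[C]_(k, n), X \is unitarymx & X *m A *m X^t* = z%:M.
Proof.
split=> [[P [[PP Pa] <- PAP]]|[X Xu XAX]].
  have rn : (\rank P <= n)%N by exact: rank_leq_col.
  exists (schmidt (row_base P)); first exact: schmidt_unitarymx.
  have /unitarymxP := schmidt_unitarymx (row_base P) rn.
  have : (schmidt (row_base P) <= P)%MS.
    by rewrite eqmx_schmidt_free ?row_base_free// eq_row_base.
  move: (schmidt _) => X /submxP[D XE] XX.
  have XP : X *m P = X by rewrite XE -mulmxA PP.
  have PX : P *m X^t* = X^t* 
    by have := congr1 (fun Z => Z^t* ) XP; rewrite adjmxM Pa.
  rewrite -PX -{1}XP mulmxA -(mulmxA X P) -(mulmxA X (P *m A)) PAP.
  by rewrite -scalemxAr -scalemxAl XP XX scalemx1.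
have XX := unitarymxP Xu.
exists (X^t* *m X); split.
- split; first by rewrite mulmxA -(mulmxA _ X) XX mulmx1.
  by rewrite adjmxM trmxCK.
- rewrite mxrankMfree ?mxrank_map ?mxrank_tr ?mxrank_unitary//.
  by rewrite /row_free mxrank_unitary.
- rewrite !mulmxA -(mulmxA (X^t* *m X) A) -(mulmxA (X^t* )) (mulmxA X).
  rewrite !mulmxA in XAX *; rewrite -(mulmxA _ X A) -(mulmxA _ (X *m A)) XAX.
  by rewrite mul_mx_scalar scalemxAl.
Qed.

(** Indexed by a complex number rather than an angle, because the directions used later arise as
    square roots of unimodular numbers. *)
Definition re_mx n (A : 'M[C]_n) (w : C) : 'M[C]_n :=
  2^-1 *: (w *: A + w^* *: A^t* ).

Lemma rotated_reE n (A : 'M[C]_n) t : rotated_re A t = re_mx A (expi t).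
Proof. by rewrite /rotated_re /re_mx /expi cosN sinN. Qed.

Lemma re_mx_hermitian n (A : 'M[C]_n) w : (re_mx A w)^t* = re_mx A w.
Proof.
apply/matrixP=> i j; rewrite !mxE !(rmorphM, rmorphD).
by rewrite /= fmorphV rmorph_nat !conjCK addrC.
Qed.

Lemma re_mx_scalar n (z w : C) :
  re_mx (z%:M : 'M[C]_n) w = ((complex.Re (w * z))%:C)%:M.
Proof.
have zc : (z%:M : 'M[C]_n)^t* = (z^*)%:M.
  by apply/matrixP=> i j; rewrite !mxE rmorphMn eq_sym.
rewrite /re_mx zc !scale_scalar_mx -raddfD /= scale_scalar_mx; congr _%:M.
by rewrite ReJ_add rmorphM/= mulrC.
Qed.

Lemma re_mx_compression k n (A : 'M[C]_n) (X : 'M[C]_(k, n)) (z w : C) :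
  X *m A *m X^t* = z%:M -> X *m re_mx A w *m X^t* = ((complex.Re (w * z))%:C)%:M.
Proof.
move=> XAX; rewrite -re_mx_scalar -XAX /re_mx !adjmxM trmxCK mulmxA.
by rewrite -scalemxAr -scalemxAl mulmxDr mulmxDl -!scalemxAr -!scalemxAl.
Qed.

Lemma sqr_cmod (z : C) : (cmod z ^+ 2)%:C = z * z^*.
Proof. by rewrite rmorphXn /= -[(cmod z)%:C]/(`|z|) sqr_normc. Qed.

Lemma cmodM (x y : C) : cmod (x * y) = cmod x * cmod y.
Proof. exact: ComplexField.Normc.normcM. Qed.

Lemma cmod_ge0 (x : C) : 0 <= cmod x.
Proof. by case: x => a b; exact: sqrtr_ge0. Qed.

(** As [a b = 1], the product is [(w^2 + conj(w)^2 + |a|^2 + |b|^2) / 4]. Here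
    [w^2 + conj(w)^2 = 4 (Re w)^2 - 2], and [|a| |b| = 1] makes [|a|^2 + |b|^2 - 2] a square. *)
Lemma re_mx_reciprocal_pair (a b w : C) : a * b = 1 -> cmod w = 1 ->
  (2^-1 * (w * a + w^* * b^*)) * (2^-1 * (w * b + w^* * a^*)) =
  ((cmod a - cmod b) ^+ 2 / 4 + complex.Re w ^+ 2)%:C.
Proof.
move=> ab w1.
have cab : cmod a * cmod b = 1.
  by rewrite -cmodM ab; exact: ComplexField.Normc.normc1.
have ab' : a^* * b^* = 1 by rewrite -rmorphM/= ab rmorph1.
have ww : w * w^* = 1 by rewrite -sqr_cmod w1 expr1n.
have wc : (complex.Re w)%:C = (w + w^*) / 2 by exact: ReJ_add.
have -> : (cmod a - cmod b) ^+ 2 / 4 = (cmod a ^+ 2 + cmod b ^+ 2 - 2) / 4.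
  by rewrite sqrrB cab; congr (_ / _); ring.
rewrite rmorphD rmorphM !(rmorphB, rmorphD) /= !sqr_cmod rmorphXn/= wc.
rewrite fmorphV !rmorph_nat.
have w2 : w ^+ 2 * (a * b) = w ^+ 2 by rewrite ab mulr1.
have w2' : w^* ^+ 2 * (a^* * b^*) = w^* ^+ 2 by rewrite ab' mulr1.
have wa : w * w^* * (a * a^* + b * b^*) = a * a^* + b * b^* by rewrite ww mul1r.
transitivity ((w ^+ 2 * (a * b) + w * w^* * (a * a^* + b * b^*) +
               w^* ^+ 2 * (a^* * b^*)) / 4).
  by field.
rewrite w2 wa w2'.
have -> : a * a^* + b * b^* - 2 = a * a^* + b * b^* - 2 * (w * w^*).
  by rewrite ww mulr1.
by field.
Qed.

(** * Characteristic polynomial of Re(w A) for a reciprocal matrix *)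

Section reciprocal.
Variables (A : 'M[C]_4) (hA : reciprocal A).
Let x1 := xi A (@Ordinal 3 0 isT).
Let x2 := xi A (@Ordinal 3 1 isT).
Let x3 := xi A (@Ordinal 3 2 isT).

Lemma re_mx_tridiagonal w (i j : 'I_4) :
  (i.+1 < j)%N || (j.+1 < i)%N -> re_mx A w i j = 0.
Proof.
move=> ij; rewrite !mxE !hA.1 ?mulr0 ?rmorph0 ?mulr0 ?addr0 ?mulr0//; lia.
Qed.

Lemma re_mx_diag w (i : 'I_4) : re_mx A w i i = 0.
Proof.
rewrite !mxE !hA.1 ?mulr0 ?rmorph0 ?mulr0 ?addr0 ?mulr0//; lia.
Qed.

Lemma re_mx_off_diag w (j : 'I_3) : cmod w = 1 ->
  re_mx A w (jl j) (jr j) * re_mx A w (jr j) (jl j) =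
  (xi A j + complex.Re w ^+ 2)%:C.
Proof. by move=> w1; rewrite !mxE re_mx_reciprocal_pair ?hA.2. Qed.

Lemma re_mx_pairs w : cmod w = 1 ->
  [/\ re_mx A w (@Ordinal 4 0 isT) (@Ordinal 4 1 isT) *
      re_mx A w (@Ordinal 4 1 isT) (@Ordinal 4 0 isT) =
      (x1 + complex.Re w ^+ 2)%:C,
      re_mx A w (@Ordinal 4 1 isT) (@Ordinal 4 2 isT) *
      re_mx A w (@Ordinal 4 2 isT) (@Ordinal 4 1 isT) =
      (x2 + complex.Re w ^+ 2)%:C &
      re_mx A w (@Ordinal 4 2 isT) (@Ordinal 4 3 isT) *
      re_mx A w (@Ordinal 4 3 isT) (@Ordinal 4 2 isT) =
      (x3 + complex.Re w ^+ 2)%:C].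
Proof.
by move=> w1; split; rewrite -re_mx_off_diag//;
  congr (re_mx A w _ _ * re_mx A w _ _); exact: val_inj.
Qed.

Lemma det_scalar_sub_re_mx (w t : C) : cmod w = 1 ->
  \det (t%:M - re_mx A w) = t ^+ 4 -
    (x1 + x2 + x3 + 3 * complex.Re w ^+ 2)%:C * t ^+ 2 +
    ((x1 + complex.Re w ^+ 2) * (x3 + complex.Re w ^+ 2))%:C.
Proof.
move=> w1; have [p1 p2 p3] := re_mx_pairs w1.
rewrite (det_scalar_sub_tridiagonal4 t (re_mx_diag w)
  (@re_mx_tridiagonal w) p1 p2 p3).
- by rewrite -!rmorphM -!rmorphD /=; congr (_ - _%:C * _ + _); ring.
Qed.

Lemma char_poly_re_mx (w : C) : cmod w = 1 ->
  char_poly (re_mx A w) = 'X^4 -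
    (x1 + x2 + x3 + 3 * complex.Re w ^+ 2)%:C%:P * 'X^2 +
    (((x1 + complex.Re w ^+ 2) * (x3 + complex.Re w ^+ 2))%:C)%:P.
Proof.
move=> w1; have [p1 p2 p3] := re_mx_pairs w1.
rewrite /char_poly /char_poly_mx.
rewrite (@det_scalar_sub_tridiagonal4 _ _ _ (x1 + complex.Re w ^+ 2)%:C%:P
  (x2 + complex.Re w ^+ 2)%:C%:P (x3 + complex.Re w ^+ 2)%:C%:P).
- by rewrite -!rmorphM -!rmorphD /=; congr (_ - _%:C%:P * _ + _); ring.
- by move=> i; rewrite mxE re_mx_diag.
- by move=> i j ij; rewrite mxE re_mx_tridiagonal.
- by rewrite 2![map_mx _ _ _ _]mxE -polyCM; congr _%:P; exact: p1.
- by rewrite 2![map_mx _ _ _ _]mxE -polyCM; congr _%:P; exact: p2.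
- by rewrite 2![map_mx _ _ _ _]mxE -polyCM; congr _%:P; exact: p3.
Qed.
End reciprocal.
End numerical_range.

(** * A membership criterion, and half-planes containing the rank-2 range *)

Section reciprocal_range.
Local Open Scope sesquilinear_scope.
Variable R : realType.
Local Notation C := R[i].

(* det (t - Re(w A)) for a reciprocal A, where c = Re w and |w| = 1. *)
Definition kippenhahn_det (A : 'M[C]_4) (c t : R) : R :=
  t ^+ 4 - (xi A (@Ordinal 3 0 isT) + xi A (@Ordinal 3 1 isT) +
            xi A (@Ordinal 3 2 isT) + 3 * c ^+ 2) * t ^+ 2 +
  (xi A (@Ordinal 3 0 isT) + c ^+ 2) * (xi A (@Ordinal 3 2 isT) + c ^+ 2).

Lemma det_kippenhahn (A : 'M[C]_4) (w : C) (t : R) :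
  reciprocal A -> cmod w = 1 ->
  \det (t%:C%:M - re_mx A w) = (kippenhahn_det A (complex.Re w) t)%:C.
Proof.
move=> hA w1; rewrite det_scalar_sub_re_mx// /kippenhahn_det.
move: (xi A _ + _ + _ + _) (_ * (xi A _ + _)) => q p.
by rewrite rmorphD rmorphB rmorphXn rmorphM rmorphXn.
Qed.

(** With [u = v^2] and [w = i v], the matrix [u M - M^*] equals [2 i v (Re(w z) - Re(w A))], so the
    hypothesis makes the pencil of [M = A - z] regular on the unit circle. On an isotropic plane of
    [M], the compression of [A] is [z]. *)
Lemma mem_rank_numerical_range (A : 'M[C]_4) (z : C) : reciprocal A ->
    (forall w, cmod w = 1 ->
      kippenhahn_det A (complex.Re w) (complex.Re (w * z)) != 0) ->
  rank_numerical_range 2 A z.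
Proof.
move=> hA chi0; pose M := A - z%:M.
have [|X Xu XMX] := @rank2_isotropic _ M; last first.
  apply/rank_numerical_rangeP; exists X => //; apply/eqP.
  rewrite -subr_eq0 -XMX /M mulmxBr mulmxBl mul_mx_scalar -scalemxAl.
  by rewrite (unitarymxP Xu) scalemx1 eqxx.
move=> u u1; have [v uE] : exists v : C, u = v ^+ 2.
  by exists (sqrtC u); rewrite sqrtCK.
have v1 : cmod v = 1.
  apply/eqP; rewrite -sqrp_eq1 ?cmod_ge0// expr2 -cmodM -expr2 -uE.
  by apply/eqP/complexI; rewrite rmorph1 -u1.
have vv : v * v^* = 1 by rewrite -sqr_cmod v1 expr1n.
pose w := 'i%C * v.
have w1 : cmod w = 1 by rewrite cmodM v1 mulr1 /cmod /= expr0n expr1n add0r sqrtr1.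
have wc : w^* = - 'i%C * v^*.
  by rewrite rmorphM; congr (_ * _); apply/eqP; rewrite eq_complex /= oppr0 !eqxx.
have ii : 'i%C ^+ 2 = -1 :> C by exact: sqr_i.
have -> : u *: M - M^t* =
    (2 * 'i%C * v) *: ((complex.Re (w * z))%:C%:M - re_mx A w).
  rewrite -re_mx_scalar; apply/matrixP=> i j; rewrite /M !mxE uE rmorphB /=.
  move: (A i j) (z *+ _) (Num.conj (A j i)) (Num.conj (_ *+ _)) => a d a' d'.
  rewrite (_ : Num.conj w = - 'i%C * v^*)// /w.
  transitivity (- 'i%C ^+ 2 * v ^+ 2 * (a - d) + 'i%C ^+ 2 * (v * v^*) * (a' - d')).
    by rewrite ii vv; ring.
  by field.
rewrite detZ det_kippenhahn// mulf_neq0 ?expf_neq0//.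
  rewrite !mulf_neq0 ?pnatr_eq0//.
    by rewrite -sqrf_eq0 ii oppr_eq0 oner_eq0.
  by apply: contra_eq_neq vv => ->; rewrite mul0r eq_sym oner_eq0.
by rewrite fmorph_eq0 chi0.
Qed.

Section factorization.
Variables (A : 'M[C]_4) (m f1 b1 f2 b2 : R).
Hypothesis hA : reciprocal A.
Hypothesis detE : forall c t, kippenhahn_det A c t =
  ((t - m * c) ^+ 2 - (f1 ^+ 2 * c ^+ 2 + b1 ^+ 2)) *
  ((t + m * c) ^+ 2 - (f2 ^+ 2 * c ^+ 2 + b2 ^+ 2)).
Hypothesis inner_roots : forall c, `|2 * m * c| <=
  Num.sqrt (f1 ^+ 2 * c ^+ 2 + b1 ^+ 2) + Num.sqrt (f2 ^+ 2 * c ^+ 2 + b2 ^+ 2).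

(** The eigenvalues of Re(w A) are [m c + r1], [m c - r1], [- m c + r2] and [- m c - r2]. By
    [inner_roots] the lower root of each factor is at most the upper root of the other, so the two
    upper roots are the two largest eigenvalues. Each in turn is taken as the exceptional [r0], the
    other being the bound. *)
Lemma rank_numerical_range_half_plane z w :
    rank_numerical_range 2 A z -> cmod w = 1 ->
  complex.Re (w * z) <= m * complex.Re w + 
    Num.sqrt (f1 ^+ 2 * complex.Re w ^+ 2 + b1 ^+ 2) /\
  complex.Re (w * z) <= - (m * complex.Re w) + 
    Num.sqrt (f2 ^+ 2 * complex.Re w ^+ 2 + b2 ^+ 2).
Proof.
move=> /rank_numerical_rangeP[X Xu XAX] w1.
have XHX := re_mx_compression w XAX.
set c := complex.Re w.
set r1 := Num.sqrt (f1 ^+ 2 * _ + _); set r2 := Num.sqrt (f2 ^+ 2 * _ + _).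
have r1E : r1 ^+ 2 = f1 ^+ 2 * c ^+ 2 + b1 ^+ 2.
  by rewrite sqr_sqrtr// addr_ge0 ?sqr_ge0// mulr_ge0 ?sqr_ge0.
have r2E : r2 ^+ 2 = f2 ^+ 2 * c ^+ 2 + b2 ^+ 2.
  by rewrite sqr_sqrtr// addr_ge0 ?sqr_ge0// mulr_ge0 ?sqr_ge0.
have r1_ge0 : 0 <= r1 := sqrtr_ge0 _.
have r2_ge0 : 0 <= r2 := sqrtr_ge0 _.
have /ler_normlP[r12 r12'] := inner_roots c.
rewrite -/r1 -/r2 in r12 r12'.
have polyE : char_poly (re_mx A w) = ('X - (- (m * c) + r2)%:C%:P) *
    ('X - (m * c + r1)%:C%:P) * ('X - (m * c - r1)%:C%:P) *
    ('X - (- (m * c) - r2)%:C%:P).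
  rewrite char_poly_re_mx//.
  have [E0 E1 E2] : [/\ (m * c) ^+ 2 * 2 + r1 ^+ 2 + r2 ^+ 2 =
      xi A (@Ordinal 3 0 isT) + xi A (@Ordinal 3 1 isT) +
      xi A (@Ordinal 3 2 isT) + 3 * c ^+ 2,
      m * c * r1 ^+ 2 = m * c * r2 ^+ 2 &
      ((m * c) ^+ 2 - r1 ^+ 2) * ((m * c) ^+ 2 - r2 ^+ 2) =
      (xi A (@Ordinal 3 0 isT) + c ^+ 2) * (xi A (@Ordinal 3 2 isT) + c ^+ 2)].
    (* The values at 0, 1 and -1 determine the coefficients; the missing linear term gives the
       second equation. *)
    have := detE c 0; have := detE c 1; have := detE c (-1).
    rewrite -r1E -r2E /kippenhahn_det; set x := _ * (xi _ _ + _).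
    by move=> e1 e2 e3; split; lra.
  rewrite -E0 -E2.
  move: (m * c) r1 r2 E1 {E0 E2 r1E r2E r1_ge0 r2_ge0 r12 r12'} => u p q E1.
  have {}E1 : u%:C%:P * p%:C%:P ^+ 2 = u%:C%:P * q%:C%:P ^+ 2 :> {poly C}.
    have /(congr1 (fun x => x%:C%:P : {poly C})) := E1.
    by rewrite !(rmorphM, rmorphXn).
  apply/eqP; rewrite -subr_eq0; apply/eqP.
  transitivity
    (2 * 'X * (u%:C%:P * p%:C%:P ^+ 2 - u%:C%:P * q%:C%:P ^+ 2) : {poly C}).
    ring.
  by rewrite E1 subrr mulr0.
have herm := re_mx_hermitian A w.
split; rewrite -lecR.
  apply: (hermitian_compression_le (r0 := (- (m * c) + r2)%:C)
    (rs := [:: (m * c + r1)%:C; (m * c - r1)%:C; (- (m * c) - r2)%:C])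
    herm _ _ Xu XHX).
    by rewrite polyE !big_cons big_nil mulr1 !mulrA.
  by rewrite /= !lecR lexx andbT /=; apply/andP; split; lra.
apply: (hermitian_compression_le (r0 := (m * c + r1)%:C)
    (rs := [:: (- (m * c) + r2)%:C; (m * c - r1)%:C; (- (m * c) - r2)%:C])
    herm _ _ Xu XHX).
  by rewrite polyE !big_cons big_nil mulr1 !mulrA; congr (_ * _ * _); rewrite mulrC.
by rewrite /= !lecR lexx andbT /=; apply/andP; split; lra.
Qed.

End factorization.
End reciprocal_range.

(** * Ellipses and elliptical disks through support functions *)

Section ellipses.
Variable R : realType.
Local Notation C := R[i].
Implicit Types (z w u : C) (m f b : R).

Lemma sqr_cmodE u : cmod u ^+ 2 = complex.Re u ^+ 2 + complex.Im u ^+ 2.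
Proof. by case: u => x y; rewrite /cmod sqr_sqrtr// addr_ge0 ?sqr_ge0. Qed.

Lemma Re_le_cmod u : complex.Re u <= cmod u.
Proof.
rewrite (le_trans (ler_norm _))// -(ler_pXn2r (n := 2)) ?nnegrE ?cmod_ge0//.
by rewrite real_normK ?num_real// sqr_cmodE lerDl sqr_ge0.
Qed.

Lemma cmod_real_ge0 (x : R) : 0 <= x -> cmod x%:C = x.
Proof. by move=> x0; rewrite /cmod /= expr0n addr0 sqrtr_sqr ger0_norm. Qed.

(** [w] is a square root of [conj(u) / |u|]. It will be the direction that makes the focal product
    of a point real and nonnegative. *)
Lemma unit_sqr_rotation u : exists2 w, cmod w = 1 & w ^+ 2 * u = (cmod u)%:C.
Proof.
have [->|u0] := eqVneq u 0.
  by exists 1; rewrite ?mulr0 /cmod ?ComplexField.Normc.normc0//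
    ComplexField.Normc.normc1.
have cu : (cmod u)%:C != 0 by rewrite -[(cmod u)%:C]/(`|u|) normr_eq0.
have wE : sqrtC (u^* / (cmod u)%:C) ^+ 2 * u = (cmod u)%:C.
  by rewrite sqrtCK mulrAC [u^* * u]mulrC -sqr_cmod rmorphXn /= expr2 mulfK.
exists (sqrtC (u^* / (cmod u)%:C)) => //.
have := congr1 (@cmod R) wE; rewrite expr2 !cmodM cmod_real_ge0 ?cmod_ge0// -expr2.
move=> /(canRL (mulfK _)); rewrite divff => [h|]; last first.
  by rewrite -(fmorph_eq0 (real_complex R)).
by apply/eqP; rewrite -sqrp_eq1 ?cmod_ge0// h// -(fmorph_eq0 (real_complex R)).
Qed.

(* This is a nonnegative real when w is normal to the bisector of the focal rays
   at z: the support function in this direction then gives the sum of the focal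
   distances, see [sqr_focal_sum]. *)
Definition focal_product m f z w : C :=
  w ^+ 2 * ((z - (m + f)%:C) * (z - (m - f)%:C)).

Lemma Im_focal_product m f z w :
  complex.Im (focal_product m f z w) =
  2 * ((complex.Re (w * z) - m * complex.Re w) *
       (complex.Im (w * z) - m * complex.Im w) -
       f ^+ 2 * complex.Re w * complex.Im w).
Proof. by case: z => x y; case: w => c s; rewrite /focal_product /=; ring. Qed.

(** In the expanded square of the sum, the squared focal distances add up by the parallelogram law,
    and their product is the modulus of the focal product. The first term on the right is
    nonnegative, and zero when the focal product is a nonnegative real. *)
Lemma sqr_focal_sum m f z w : cmod w = 1 ->
  (cmod (z - (m + f)%:C) + cmod (z - (m - f)%:C)) ^+ 2 - 4 * f ^+ 2 =
  2 * (cmod (focal_product m f z w) - complex.Re (focal_product m f z w)) +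
  4 * ((complex.Re (w * z) - m * complex.Re w) ^+ 2 - f ^+ 2 * complex.Re w ^+ 2).
Proof.
move=> w1; rewrite {1}/focal_product expr2 !cmodM w1 !mul1r -expr2.
set p := cmod (z - (m + f)%:C); set q := cmod (z - (m - f)%:C).
have pq : p ^+ 2 + q ^+ 2 =
    2 * ((complex.Re z - m) ^+ 2 + complex.Im z ^+ 2 + f ^+ 2).
  by rewrite !sqr_cmodE; case: z {p q} => x y /=; ring.
have cs : complex.Re w ^+ 2 + complex.Im w ^+ 2 = 1 by rewrite -sqr_cmodE w1 expr1n.
have ReE : complex.Re (focal_product m f z w) =
    2 * ((complex.Re (w * z) - m * complex.Re w) ^+ 2 - f ^+ 2 * complex.Re w ^+ 2) -
    (complex.Re w ^+ 2 + complex.Im w ^+ 2) *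
    ((complex.Re z - m) ^+ 2 + complex.Im z ^+ 2 - f ^+ 2).
  rewrite /focal_product; case: z {p q pq} => x y.
  by case: w {w1 cs} => c s /=; ring.
by rewrite ReE cs; move: pq; lra.
Qed.

Lemma major_half_axisE m f b :
  major_half_axis (m + f)%:C (m - f)%:C b = Num.sqrt (b ^+ 2 + f ^+ 2).
Proof.
rewrite /major_half_axis -rmorphB /cmod /=; congr (Num.sqrt (_ + _)).
by rewrite exprMn sqr_sqrtr expr0n addr0 ?sqr_ge0//; field.
Qed.

Lemma sqr_focal_bound m f b z :
  (cmod (z - (m + f)%:C) + cmod (z - (m - f)%:C) <=
    2 * major_half_axis (m + f)%:C (m - f)%:C b) =
  ((cmod (z - (m + f)%:C) + cmod (z - (m - f)%:C)) ^+ 2 - 4 * f ^+ 2 <=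
    4 * b ^+ 2).
Proof.
rewrite major_half_axisE -(ler_pXn2r (n := 2)) ?nnegrE ?addr_ge0 ?cmod_ge0//.
  by rewrite exprMn sqr_sqrtr ?addr_ge0 ?sqr_ge0//; apply/idP/idP; lra.
Qed.

(** By [sqr_focal_sum], the left side of that identity is the maximum over [w] of its last term,
    reached at the [w] of [unit_sqr_rotation]. *)
Lemma elliptical_diskP m f b z :
  elliptical_disk (m + f)%:C (m - f)%:C b z <->
  forall w, cmod w = 1 -> (complex.Re (w * z) - m * complex.Re w) ^+ 2 <=
    f ^+ 2 * complex.Re w ^+ 2 + b ^+ 2.
Proof.
rewrite /elliptical_disk /= sqr_focal_bound; split=> [pq w w1|H].
  have := sqr_focal_sum m f z w1; have := Re_le_cmod (focal_product m f z w).
  by move: pq; lra.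
have [w w1 wE] := unit_sqr_rotation ((z - (m + f)%:C) * (z - (m - f)%:C)).
have := H _ w1; have := sqr_focal_sum m f z w1.
rewrite /focal_product wE [cmod (cmod _)%:C]cmod_real_ge0 ?cmod_ge0//=.
lra.
Qed.

(** The first equation puts [z] on a support line, and the second, which says that the focal product
    is real, is the derivative of the first along the unit circle. Together they are the envelope
    equations. *)
Lemma ellipseP m f b z : b != 0 ->
  ellipse (m + f)%:C (m - f)%:C b z <->
  exists2 w, cmod w = 1 &
    (complex.Re (w * z) - m * complex.Re w) ^+ 2 =
      f ^+ 2 * complex.Re w ^+ 2 + b ^+ 2 /\
    (complex.Re (w * z) - m * complex.Re w) *
      (complex.Im (w * z) - m * complex.Im w) =
      f ^+ 2 * complex.Re w * complex.Im w.
Proof.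
move=> b0; rewrite /ellipse /= (negPf b0).
have sqE : (cmod (z - (m + f)%:C) + cmod (z - (m - f)%:C) =
    2 * major_half_axis (m + f)%:C (m - f)%:C b) <->
  ((cmod (z - (m + f)%:C) + cmod (z - (m - f)%:C)) ^+ 2 - 4 * f ^+ 2 =
    4 * b ^+ 2).
  rewrite major_half_axisE; set q := _ + cmod _; set a := Num.sqrt _.
  have aE : a ^+ 2 = b ^+ 2 + f ^+ 2 by rewrite sqr_sqrtr ?addr_ge0 ?sqr_ge0.
  split=> [->|qE]; first by rewrite exprMn aE; ring.
  apply/eqP; rewrite -(eqrXn2 (n := 2)) ?addr_ge0 ?cmod_ge0 ?mulr_ge0 ?sqrtr_ge0//.
  by rewrite exprMn aE; apply/eqP; move: qE; lra.
split=> [/sqE pq|[w w1 [XX XY]]]; last apply/sqE.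
  have [w w1 wE] := unit_sqr_rotation ((z - (m + f)%:C) * (z - (m - f)%:C)).
  exists w => //; have := sqr_focal_sum m f z w1; have := Im_focal_product m f z w.
  rewrite /focal_product wE [cmod (cmod _)%:C]cmod_real_ge0 ?cmod_ge0//= pq.
  by split; lra.
have Im0 := Im_focal_product m f z w; rewrite XY subrr mulr0 in Im0.
have := sqr_focal_sum m f z w1; rewrite XX.
suff -> : cmod (focal_product m f z w) = complex.Re (focal_product m f z w) by lra.
set X := _ - _ in XX XY; set Y := _ - _ in XY.
have ReE : complex.Re (focal_product m f z w) =
    X ^+ 2 - f ^+ 2 * complex.Re w ^+ 2 - (Y ^+ 2 - f ^+ 2 * complex.Im w ^+ 2).
  rewrite /focal_product /X /Y; case: z {X Y sqE XX XY Im0} => x y.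
  by case: w {w1} => c s /=; ring.
(* A real focal product could still be negative. This bound excludes it; dividing by [X ^+ 2] is
   allowed because [b] is nonzero. *)
have Y_le : Y ^+ 2 <= f ^+ 2 * complex.Im w ^+ 2.
  have X_gt0 : 0 < X ^+ 2.
    have b2 : 0 < b ^+ 2 by rewrite lt_def sqrf_eq0 b0 sqr_ge0.
    by rewrite XX; have := mulr_ge0 (sqr_ge0 f) (sqr_ge0 (complex.Re w)); lra.
  rewrite -(ler_pM2l X_gt0) -exprMn XY XX -subr_ge0.
  rewrite (_ : _ - _ = (f * complex.Im w * b) ^+ 2) ?sqr_ge0//.
  ring.
apply/eqP; rewrite -(eqrXn2 (n := 2)) ?cmod_ge0//.
  by rewrite sqr_cmodE Im0 expr0n addr0.
by move: Y_le; rewrite ReE XX; have := sqr_ge0 b; lra.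
Qed.
End ellipses.

(** * Accumulation of zeros at a point *)

Section zero_accumulation.
Variable R : realType.
Implicit Types (f g : R -> R) (t : R).

(* The zeros of f accumulate at t.  This passes from a product to one of its
   factors, and forces the derivative at t to vanish. *)
Definition zeros_at f t := ~ \forall s \near t^', f s != 0.

Lemma zeros_atM f g t : zeros_at (f \* g) t -> zeros_at f t \/ zeros_at g t.
Proof.
move=> fg; apply: contrapT => /not_orP[/contrapT f0 /contrapT g0]; apply: fg.
by near=> s; rewrite mulf_neq0//; near: s.
Unshelve. all: by end_near. Qed.

Lemma zeros_at_all f t : (forall s, f s = 0) -> zeros_at f t.
Proof.
by move=> f0 H; have [s] := @filter_ex _ _ (Proper_dnbhs_numFieldType t) _ H;
  rewrite f0 eqxx.
Qed.

(** Write [f s - f t = g s * (s - t)] with [g] continuous at [t] and [g t = df]. If [f t], or else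
    [g t], were nonzero, [f] would have no zeros in a punctured neighbourhood of [t]. *)
Lemma zeros_at_derive f t df : is_derive t 1 f df -> zeros_at f t ->
  f t = 0 /\ df = 0.
Proof.
move=> /is_derive1_caratheodory[g [fg gc <-]] acc.
have ft : f t = 0.
  apply: contrapT => /eqP ft; apply: acc.
  have fc : f @ t --> f t.
    have -> : f = (fun s => f t + g s * (s - t)).
      by apply/funext => s; rewrite -fg addrC subrK.
    rewrite subrr mulr0 addr0.
    rewrite -[X in _ --> X]addr0 -[X in _ --> _ + X](mulr0 (g t)) -(subrr t).
    apply: cvgD; first exact: cvg_cst.
    by apply: cvgM => //; apply: cvgB => //; exact: cvg_cst.
  apply: cvg_within; exact: cvgr_neq0 fc ft.
split=> //; apply: contrapT => /eqP gt; apply: acc.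
have gn : \forall s \near t^', g s != 0.
  apply: cvg_within; exact: cvgr_neq0 gc gt.
near=> s; have := fg s; rewrite ft subr0 => ->.
rewrite mulf_neq0//; first by near: s.
rewrite subr_eq0; near: s; exact: nbhs_dnbhs_neq.
Unshelve. all: by end_near. Qed.
End zero_accumulation.

(** * The Kippenhahn curve as a union of two ellipses *)

Section kippenhahn.
Variable R : realType.
Local Notation C := R[i].

Lemma cmod_expi (t : R) : cmod (expi t) = 1.
Proof. by rewrite /cmod /= cos2Dsin2 sqrtr1. Qed.

Lemma unit_expi (w : C) : cmod w = 1 -> exists t, w = expi t.
Proof.
move=> w1; have := sqr_cmodE w; rewrite w1 expr1n; case: w {w1} => c s /= cs.
have c1 : -1 <= c <= 1 by apply/andP; split; nra.
have sE : sin (acos c) = `|s|.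
  by rewrite sin_acos// (_ : 1 - _ = s ^+ 2) ?sqrtr_sqr//; lra.
have cE : cos (acos c) = c by rewrite acosK ?in_itv.
have [s0|s0] := lerP 0 s.
  by exists (acos c); rewrite /expi cE sE ger0_norm.
by exists (- acos c); rewrite /expi cosN sinN cE sE ltr0_norm// opprK.
Qed.

Lemma eigenvalue_rotated_re (A : 'M[C]_4) (t l : R) : reciprocal A ->
  eigenvalue (rotated_re A t) l%:C <-> kippenhahn_det A (cos t) l = 0.
Proof.
move=> hA; rewrite rotated_reE eigenvalue_root_char /root.
rewrite char_poly_re_mx ?cmod_expi// !hornerE /=.
rewrite (_ : _ + _ = (kippenhahn_det A (cos t) l)%:C).
  by rewrite fmorph_eq0; split=> /eqP.
rewrite /kippenhahn_det; ring.
Qed.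

Section factorization.
Variables (A : 'M[C]_4) (m f1 b1 f2 b2 : R).
Hypothesis hA : reciprocal A.
Hypothesis detE : forall c t, kippenhahn_det A c t =
  ((t - m * c) ^+ 2 - (f1 ^+ 2 * c ^+ 2 + b1 ^+ 2)) *
  ((t + m * c) ^+ 2 - (f2 ^+ 2 * c ^+ 2 + b2 ^+ 2)).

(** For [b = 0] the eigenvalue branches [(n + f) cos t] and [(n - f) cos t] give the lines through
    the foci. For [b != 0] the radicand stays positive, so a branch with a fixed sign of the square
    root is differentiable. *)
Lemma ellipse_sub_kippenhahn_curve (n f b : R) :
    (forall c t, (t - n * c) ^+ 2 = f ^+ 2 * c ^+ 2 + b ^+ 2 ->
       kippenhahn_det A c t = 0) ->
  ellipse (n + f)%:C (n - f)%:C b `<=` kippenhahn_curve A.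
Proof.
move=> det0 z; have [b0|b0] := eqVneq b 0.
  have foci (g : R) : g ^+ 2 = f ^+ 2 -> kippenhahn_curve A (n + g)%:C.
    move=> gf; exists (fun t => (n + g) * cos t); split.
    - move=> t; apply/eigenvalue_rotated_re => //; apply: det0.
      rewrite b0 -gf; ring.
    - by move=> t; exact: ex_derive.
    have line0 : (fun s => line_eqn (n + g)%:C s ((n + g) * cos s)) = cst 0.
      by apply/funext => s; rewrite /line_eqn /=; ring.
    exists 0; split; first by have := congr1 (fun h => h 0) line0.
    by rewrite line0; exact: is_derive_cst.
  rewrite /ellipse /= b0 eqxx => -[->|->]; first exact: foci.
  by apply: foci; rewrite sqrrN.
move=> /(ellipseP _ _ _ b0)[w /unit_expi[t ->] /= []].
case: z => x y; set c := cos t; set s := sin t; rewrite /= -/c -/s => XX XY.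
pose h u := f ^+ 2 * cos u ^+ 2 + b ^+ 2.
have h_gt0 u : 0 < h u.
  have bb : 0 < b ^+ 2 by rewrite lt_def sqrf_eq0 b0 sqr_ge0.
  by have := mulr_ge0 (sqr_ge0 f) (sqr_ge0 (cos u)); rewrite /h; lra.
(* The sign selects the branch whose line at angle [t] passes through [z]. *)
pose e : R := if 0 <= c * x - s * y - n * c then 1 else -1.
have ee : e ^+ 2 = 1 by rewrite /e; case: ifP; rewrite ?sqrrN expr1n.
have Xe : c * x - s * y - n * c = e * Num.sqrt (h t).
  rewrite /h -XX sqrtr_sqr /e; case: ifPn => [X0|]; first by rewrite mul1r ger0_norm.
  by rewrite -ltNge => X0; rewrite ltr0_norm// mulN1r opprK.
have h_der u : is_derive u (1 : R) h (- (2 * f ^+ 2 * cos u * sin u)).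
  apply: is_derive_eq; rewrite /GRing.scale /= ; ring.
have sqrth_der u : is_derive u (1 : R) (Num.sqrt \o h)
    ((2 * Num.sqrt (h u))^-1 * - (2 * f ^+ 2 * cos u * sin u)).
  by apply: is_derive1_comp; exact: is_derive1_sqrt.
pose mu u := n * cos u + e * (Num.sqrt \o h) u.
have mu_der u : is_derive u (1 : R) mu
    (- (n * sin u) - e * (f ^+ 2 * cos u * sin u / Num.sqrt (h u))).
  have sh : Num.sqrt (h u) != 0 by rewrite gt_eqF// sqrtr_gt0.
  apply: is_derive_eq; rewrite /GRing.scale /=; field.
  by rewrite sh.
exists mu; split.
- move=> u; apply/eigenvalue_rotated_re => //; apply: det0.
  by rewrite addrAC subrr add0r exprMn ee mul1r sqr_sqrtr// ltW.
- by move=> u; exact: ex_derive.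
exists t; split.
  by rewrite /line_eqn /mu /= -Xe -/c -/s; ring.
rewrite /line_eqn /=; apply: is_derive_eq; rewrite /GRing.scale /= -/c -/s.
have sh : Num.sqrt (h t) != 0 by rewrite gt_eqF// sqrtr_gt0.
have -> : f ^+ 2 * c * s / Num.sqrt (h t) = e * (c * y + s * x - n * s).
  by rewrite -XY Xe; field.
rewrite mulrA -expr2 ee; ring.
Qed.

(** A differentiable selection [mu] may switch between the factors at [t], so neither factor need
    vanish along [mu] near [t]. The zeros of one of them nevertheless accumulate at [t], so that
    factor and its derivative vanish there, which are the equations of [ellipseP]. *)
Lemma kippenhahn_curve_sub :
  kippenhahn_curve A `<=` ellipse (m + f1)%:C (m - f1)%:C b1 `|`
                          ellipse (- m + f2)%:C (- m - f2)%:C b2.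
Proof.
move=> z [mu [mu_eig mu_der [t [line0 line'0]]]].
set x := complex.Re z; set y := complex.Im z.
have mu_t : mu t = cos t * x - sin t * y.
  by move: line0; rewrite /line_eqn /x /y; case: (z) => ? ? /=; lra.
have mu'_t : is_derive t (1 : R) mu (- sin t * x - cos t * y).
  have -> : mu = (fun s => (cos s * x - sin s * y) - line_eqn z s (mu s)).
    by apply/funext => s; rewrite /line_eqn /x /y; case: (z) => ? ? /=; ring.
  apply: is_derive_eq; rewrite /GRing.scale /=; ring.
pose g n f b s := (mu s - n * cos s) ^+ 2 - (f ^+ 2 * cos s ^+ 2 + b ^+ 2).
have zg n f b : zeros_at (g n f b) t -> ellipse (n + f)%:C (n - f)%:C b z.
  have cs1 := cos2Dsin2 t.
  have [->|b0] := eqVneq b 0; last first.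
    have g'_t : is_derive t (1 : R) (g n f b)
        (2 * (mu t - n * cos t) * (- sin t * x - cos t * y + n * sin t) +
         2 * f ^+ 2 * cos t * sin t).
      apply: is_derive_eq; rewrite /GRing.scale /=; ring.
    move=> /(zeros_at_derive g'_t); rewrite /g mu_t => -[g0 g'0].
    apply/(ellipseP _ _ _ b0); exists (expi t); first exact: cmod_expi.
    rewrite (_ : z = x +i* y) /=; last by rewrite /x /y; case: (z).
    by split; lra.
  (* For b = 0 the quadratic factor splits into two linear ones, each of them
     carrying one of the foci. *)
  have foci h : zeros_at (fun s => mu s - (n + h) * cos s) t -> z = (n + h)%:C.
    have d : is_derive t (1 : R) (fun s => mu s - (n + h) * cos s)
        (- sin t * x - cos t * y + (n + h) * sin t).
      apply: is_derive_eq; rewrite /GRing.scale /=; ring.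
    move=> /(zeros_at_derive d); rewrite mu_t => -[E0 E1].
    have xE : x = n + h.
      apply/eqP; rewrite -subr_eq0 -[_ - _]mulr1 -cs1; apply/eqP.
      transitivity (cos t * (cos t * x - sin t * y - (n + h) * cos t) -
        sin t * (- sin t * x - cos t * y + (n + h) * sin t)); first ring.
      by rewrite E0 E1 !mulr0 subrr.
    have yE : y = 0.
      apply: oppr_inj; rewrite oppr0 -[- y]mulr1 -cs1.
      transitivity (sin t * (cos t * x - sin t * y - (n + h) * cos t) +
        cos t * (- sin t * x - cos t * y + (n + h) * sin t)); first ring.
      by rewrite E0 E1 !mulr0 addr0.
    by rewrite -xE /real_complex_def -yE /x /y; case: (z).
  have -> : g n f 0 = (fun s => mu s - (n + f) * cos s) \*
                      (fun s => mu s - (n - f) * cos s).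
    by apply/funext => s; rewrite /g /=; ring.
  by rewrite /ellipse /= eqxx => /zeros_atM[/foci|/foci]; [left|right].
have : zeros_at (g m f1 b1 \* g (- m) f2 b2) t.
  apply: zeros_at_all => s /=.
  have /(eigenvalue_rotated_re _ _ hA) := mu_eig s.
  by rewrite detE /g mulNr opprK.
by move=> /zeros_atM[/zg|/zg]; [left|right].
Qed.

Lemma kippenhahn_curve_ellipses :
  kippenhahn_curve A = ellipse (m + f1)%:C (m - f1)%:C b1 `|`
                       ellipse (- m + f2)%:C (- m - f2)%:C b2.
Proof.
apply/seteqP; split; first exact: kippenhahn_curve_sub.
by rewrite subUset; split; apply: ellipse_sub_kippenhahn_curve => c t tE;
  rewrite detE; [rewrite tE subrr mul0r|rewrite -[m * c]opprK -mulNr tE subrr mulr0].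
Qed.
End factorization.
End kippenhahn.

(** * Closedness of the rank-k numerical range under approximation of the matrix *)

Section limit.
Local Open Scope sesquilinear_scope.
Variable R : realType.
Local Notation C := R[i].

Section continuous_complex.
Variable T : topologicalType.
Implicit Types F G : T -> C.

(* Componentwise continuity: R[i] carries no topology here. *)
Definition ccontinuous F :=
  continuous (@complex.Re R \o F) /\ continuous (@complex.Im R \o F).

Lemma ccontinuous_cst c : ccontinuous (fun=> c).
Proof. by split=> x; exact: cvg_cst. Qed.

Lemma ccontinuousD F G : ccontinuous F -> ccontinuous G ->
  ccontinuous (fun x => F x + G x).
Proof.
move=> [F1 F2] [G1 G2]; split.
  rewrite (_ : _ \o _ = (fun x => (@complex.Re R \o F) x + (@complex.Re R \o G) x)).
    by move=> x; apply: cvgD; [exact: F1|exact: G1].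
  by apply/funext => x /=; case: (F x) (G x) => ? ? [].
rewrite (_ : _ \o _ = (fun x => (@complex.Im R \o F) x + (@complex.Im R \o G) x)).
  by move=> x; apply: cvgD; [exact: F2|exact: G2].
by apply/funext => x /=; case: (F x) (G x) => ? ? [].
Qed.

Lemma ccontinuousM F G : ccontinuous F -> ccontinuous G ->
  ccontinuous (fun x => F x * G x).
Proof.
move=> [F1 F2] [G1 G2]; split.
  rewrite (_ : _ \o _ = (fun x => (@complex.Re R \o F) x * (@complex.Re R \o G) x -
    (@complex.Im R \o F) x * (@complex.Im R \o G) x)).
    by move=> x; apply: cvgB; apply: cvgM;
      [exact: F1|exact: G1|exact: F2|exact: G2].
  by apply/funext => x /=; case: (F x) (G x) => ? ? [].
rewrite (_ : _ \o _ = (fun x => (@complex.Re R \o F) x * (@complex.Im R \o G) x +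
    (@complex.Im R \o F) x * (@complex.Re R \o G) x)).
  by move=> x; apply: cvgD; apply: cvgM;
    [exact: F1|exact: G2|exact: F2|exact: G1].
by apply/funext => x /=; case: (F x) (G x) => ? ? [].
Qed.

Lemma ccontinuous_conj F : ccontinuous F -> ccontinuous (fun x => (F x)^* ).
Proof.
move=> [F1 F2]; split.
  rewrite (_ : _ \o _ = @complex.Re R \o F)//.
  by apply/funext => x /=; case: (F x).
rewrite (_ : _ \o _ = (fun x => - (@complex.Im R \o F) x)).
  by move=> x; apply: cvgN; exact: F2.
by apply/funext => x /=; case: (F x).
Qed.

Lemma ccontinuous_sum (I : Type) (r : seq I) (F : I -> T -> C) :
  (forall i, ccontinuous (F i)) -> ccontinuous (fun x => \sum_(i <- r) F i x).
Proof.
move=> Fc; elim: r => [|i r IH].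
  rewrite (_ : (fun _ => _) = fun=> 0); first exact: ccontinuous_cst.
  by apply/funext => x; rewrite big_nil.
rewrite (_ : (fun _ => _) = fun x => F i x + \sum_(j <- r) F j x).
  exact: ccontinuousD.
by apply/funext => x; rewrite big_cons.
Qed.

Lemma continuous_sumr (I : Type) (r : seq I) (f : I -> T -> R) :
  (forall i, continuous (f i)) -> continuous (fun x => \sum_(i <- r) f i x).
Proof.
move=> fc; elim: r => [|i r IH] x.
  rewrite (_ : (fun _ => _) = fun=> 0); first exact: cvg_cst.
  by apply/funext => y; rewrite big_nil.
rewrite (_ : (fun _ => _) = fun x => f i x + \sum_(j <- r) f j x).
  by apply: cvgD; [exact: fc|exact: IH].
by apply/funext => y; rewrite big_cons.
Qed.

Lemma continuous_cmod F : ccontinuous F -> continuous (@cmod R \o F).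
Proof.
move=> [F1 F2] x; rewrite (_ : _ \o F = Num.sqrt \o
  (fun x => (@complex.Re R \o F) x ^+ 2 + (@complex.Im R \o F) x ^+ 2)); last first.
  by apply/funext => y; rewrite /cmod /=; case: (F y).
apply: continuous_comp; last exact: sqrt_continuous.
by apply: cvgD; apply: cvgM; [exact: F1|exact: F1|exact: F2|exact: F2].
Qed.
End continuous_complex.

Lemma cmod_eq0 (u : C) : cmod u = 0 -> u = 0.
Proof. exact: ComplexField.Normc.eq0_normc. Qed.

Lemma norm_cmod (u : C) : `|u| = (cmod u)%:C.
Proof. by []. Qed.

Lemma unitarymx_norm_le1 k n (X : 'M[C]_(k, n)) i j :
  X \is unitarymx -> `|X i j| <= 1.
Proof.
move=> /unitarymxP/matrixP/(_ i i); rewrite !mxE eqxx => XX.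
rewrite -(ler_pXn2r (n := 2)) ?nnegrE// expr1n.
rewrite -[leRHS]XX (bigD1 j)//= !mxE normCK lerDl sumr_ge0// => l _.
by rewrite !mxE -normCK exprn_ge0.
Qed.

Lemma compression_norm_le k n (X : 'M[C]_(k, n)) (D : 'M[C]_n) (e : C) i j :
    X \is unitarymx -> (forall p q, `|D p q| <= e) ->
  `|(X *m D *m X^t* ) i j| <= e *+ n *+ n.
Proof.
move=> Xu De; have X1 := fun i j => unitarymx_norm_le1 i j Xu.
have le_sum (f : 'I_n -> C) (c : C) : (forall q, `|f q| <= c) ->
    `|\sum_q f q| <= c *+ n.
  move=> fc; rewrite (le_trans (ler_norm_sum _ _ _))//.
  by rewrite (le_trans (ler_sum _ (fun q _ => fc q)))// sumr_const card_ord.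
have XD_le q : `|(X *m D) i q| <= e *+ n.
  by rewrite mxE; apply: le_sum => p; rewrite normrM -[leRHS]mul1r ler_pM.
rewrite mxE; apply: le_sum => q; rewrite normrM -[leRHS]mulr1.
by apply: ler_pM => //; rewrite !mxE norm_conjC.
Qed.

(** The defect [F] of the equations [X X^* = 1] and [X A X^* = z] is continuous and attains its
    minimum on a compact box. An isometry for a matrix [A'] close to [A] has small defect for [A],
    so the minimum is 0. *)
Lemma rank_numerical_range_limit k n (A : 'M[C]_n) (z : C) :
    (forall e : R, 0 < e -> exists2 A' : 'M[C]_n,
       forall i j, cmod (A i j - A' i j) <= e & rank_numerical_range k A' z) ->
  rank_numerical_range k A z.
Proof.
move=> approx.
pose I := ('I_k * 'I_n * bool)%type.
pose T := prod_topology (fun _ : I => R).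
pose mx (v : T) : 'M[C]_(k, n) :=
  \matrix_(i, j) (v (i, j, true) +i* v (i, j, false)).
pose F1 v := mx v *m (mx v)^t* - 1%:M.
pose F2 v := mx v *m A *m (mx v)^t* - z%:M.
pose F v := \sum_i \sum_j cmod (F1 v i j) + \sum_i \sum_j cmod (F2 v i j).
have mx_cont i j : ccontinuous (fun v => mx v i j).
  split.
    rewrite (_ : _ \o _ = @proj I (fun=> R) (i, j, true)).
      exact: proj_continuous.
    by apply/funext => v /=; rewrite mxE.
  rewrite (_ : _ \o _ = @proj I (fun=> R) (i, j, false)).
    exact: proj_continuous.
  by apply/funext => v /=; rewrite mxE.
have F_cont : continuous F.
  have sum2_cont m (G : T -> 'M[C]_(k, m)) :
      (forall i j, ccontinuous (fun v => G v i j)) ->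
      continuous (fun v => \sum_i \sum_j cmod (G v i j)).
    move=> Gc; do 2 (apply: continuous_sumr => ?); exact: continuous_cmod.
  have mul_cont m p q (G : T -> 'M[C]_(m, p)) (H : T -> 'M[C]_(p, q)) :
      (forall i j, ccontinuous (fun v => G v i j)) ->
      (forall i j, ccontinuous (fun v => H v i j)) ->
      forall i j, ccontinuous (fun v => (G v *m H v) i j).
    move=> Gc Hc i j; rewrite (_ : (fun _ => _) = fun v => \sum_l G v i l * H v l j).
      by apply: ccontinuous_sum => l; exact: ccontinuousM.
    by apply/funext => v; rewrite mxE.
  have sub_cont m q (G : T -> 'M[C]_(m, q)) (M : 'M[C]_(m, q)) :
      (forall i j, ccontinuous (fun v => G v i j)) ->
      forall i j, ccontinuous (fun v => (G v - M) i j).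
    move=> Gc i j; rewrite (_ : (fun _ => _) = fun v => G v i j + - M i j).
      by apply: ccontinuousD => //; exact: ccontinuous_cst.
    by apply/funext => v; rewrite !mxE.
  have adj_cont i j : ccontinuous (fun v => (mx v)^t* i j).
    rewrite (_ : (fun _ => _) = fun v => (mx v j i)^* ); first exact: ccontinuous_conj.
    by apply/funext => v; rewrite !mxE.
  have c1 := sub_cont _ _ _ 1%:M (mul_cont _ _ _ _ _ mx_cont adj_cont).
  have A_cont i j : ccontinuous (fun v : T => A i j) by exact: ccontinuous_cst.
  have c2 := sub_cont _ _ _ z%:M
    (mul_cont _ _ _ _ _ (mul_cont _ _ _ _ (fun=> A) mx_cont A_cont) adj_cont).
  have {}c1 := sum2_cont _ _ c1; have {}c2 := sum2_cont _ _ c2.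
  by move=> v; exact: (cvgD (c1 v) (c2 v)).
(* The box contains the coordinates of every isometry, whose entries have modulus at most 1. *)
pose B : set T := [set v | forall i, `[-1, 1]%classic (v i)].
have [|||c _ cmin] := @compact_EVT_min T R F B.
- by exists (fun=> 0) => i /=; rewrite in_itv /= lerN10 ler01.
- have box (i : I) : compact (`[-1, 1]%classic : set R) by exact: segment_compact.
  exact: (@tychonoff I (fun=> R) (fun=> `[-1, 1]%classic) box).
- exact: continuous_subspaceT.
have F0 v : F v = 0 -> mx v *m (mx v)^t* = 1%:M /\ mx v *m A *m (mx v)^t* = z%:M.
  have sum_ge m (G : 'M[C]_(k, m)) : 0 <= \sum_i \sum_j cmod (G i j).
    by do 2 (apply: sumr_ge0 => ? _); exact: cmod_ge0.
  have sum0 m (G : 'M[C]_(k, m)) : \sum_i \sum_j cmod (G i j) = 0 -> G = 0.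
    move=> G0; apply/matrixP => i j; rewrite mxE; apply: cmod_eq0.
    have row_ge0 i' : 0 <= \sum_j cmod (G i' j).
      by apply: sumr_ge0 => j' _; exact: cmod_ge0.
    have := @psumr_eq0P _ _ _ _ (fun i' _ => row_ge0 i') G0 i isT.
    by move=> /psumr_eq0P; apply=> // j' _; exact: cmod_ge0.
  move=> /eqP; rewrite paddr_eq0 ?sum_ge// => /andP[/eqP/sum0/eqP] + /eqP/sum0/eqP.
  by rewrite !subr_eq0 => /eqP ? /eqP.
suff /F0[/unitarymxP Xu XAX] : F c = 0.
  by apply/rank_numerical_rangeP; exists (mx c).
have F_ge0 : 0 <= F c.
  by apply: addr_ge0; do 2 (apply: sumr_ge0 => ? _); exact: cmod_ge0.
apply/eqP; rewrite eq_le F_ge0 andbT; apply/ler_addgt0Pr => e e0; rewrite add0r.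
(* Each of the [k * k] entries contributes at most [n * n] times the distance of the matrices; the
   successor keeps [K] positive. *)
pose K : R := (n * n * (k * k)).+1%:R.
have K0 : 0 < K by rewrite ltr0n.
have [|A' AA' /rank_numerical_rangeP[X Xu XAX]] := approx (e / K).
  by rewrite divr_gt0.
pose v : T := fun p : I => let x := X p.1.1 p.1.2 in
  if p.2 then complex.Re x else complex.Im x.
have vX : mx v = X.
  by apply/matrixP=> i j; rewrite mxE /v /=; case: (X i j).
apply: (@le_trans _ _ (F v)).
  apply: cmin; rewrite inE => -[[i j] b] /=; rewrite in_itv /= -ler_norml.
  have := unitarymx_norm_le1 i j Xu.
  rewrite norm_cmod -[1]/(1%:C) lecR => X1.
  have := sqr_cmodE (X i j); rewrite /v /= ler_norml.
  by have := cmod_ge0 (X i j); case: b => *; apply/andP; split; nra.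
rewrite /F /F1 /F2 vX (unitarymxP Xu) subrr.
rewrite [X in X + _]big1 ?add0r => [|i _]; last first.
  by rewrite big1// => j _; rewrite mxE /cmod ComplexField.Normc.normc0.
have -> : X *m A *m X^t* - z%:M = X *m (A - A') *m X^t*.
  by rewrite mulmxBr mulmxBl XAX.
have le_entry i j : cmod ((X *m (A - A') *m X^t* ) i j) <= e / K *+ n *+ n.
  rewrite -lecR -norm_cmod !rmorphMn /=.
  apply: compression_norm_le => // p q; rewrite !mxE.
  by rewrite norm_cmod lecR.
apply: (@le_trans _ _ (\sum_(i < k) \sum_(j < k) e / K *+ n *+ n)).
  by do 2 (apply: ler_sum => ? _); exact: le_entry.
rewrite !sumr_const !card_ord -!mulrnA -mulr_natr mulrAC ler_pdivrMr//.
by rewrite ler_pM2l// ler_nat mulnA leqnSn.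
Qed.
End limit.

(** * Small perturbations that increase chosen parameters *)

Section perturbation.
Variable R : realType.
Local Notation C := R[i].

(** The intermediate value theorem on [[1, 1 + eta]]: since [r >= 1], the function [f] is larger at
    the right end than at 1. *)
Lemma modulus_perturbation_ge1 (r eta : R) : 1 <= r -> 0 < eta ->
  exists2 d0, 0 < d0 & forall d, 0 <= d <= d0 -> exists2 s, 1 <= s <= 1 + eta &
    (s * r - (s * r)^-1) ^+ 2 = (r - r^-1) ^+ 2 + d.
Proof.
move=> r1 eta0; pose f s := (s * r - (s * r)^-1) ^+ 2.
have r0 : 0 < r by lra.
have f_cont : {within `[1, 1 + eta], continuous f}.
  apply: continuous_in_subspaceT => s; rewrite inE /= in_itv /= => /andP[s1 _].
  have sr : s * r != 0 by rewrite gt_eqF// mulr_gt0//; lra.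
  have cM : {for s, continuous (fun s : R => s * r)}.
    by apply: cvgM; [exact: cvg_id|exact: cvg_cst].
  have cV : {for s, continuous (fun s : R => (s * r)^-1)} by exact: cvgV.
  by apply: cvgM; exact: cvgB.
have rV1 : r^-1 <= 1 by rewrite invf_le1.
have f1 : f 1 < f (1 + eta).
  rewrite /f mul1r; set t := (1 + eta) * r.
  have rt : r < t by rewrite /t ltr_pMl//; lra.
  have tV : t^-1 < r^-1 by rewrite ltf_pV2 ?posrE// (lt_trans r0).
  by rewrite -subr_gt0 subr_sqr mulr_gt0//; lra.
exists (f (1 + eta) - f 1); first by rewrite subr_gt0.
move=> d /andP[d0 dle].
have [||s] := @IVT R f 1 (1 + eta) (f 1 + d) _ f_cont.
- by rewrite lerDl ltW.
- by rewrite ge_min le_max; apply/andP; split; apply/orP; [left|right]; lra.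
by rewrite in_itv /= => s1 fs; exists s => //; rewrite -/(f s) fs /f mul1r.
Qed.

Lemma modulus_perturbation (r eta : R) : 0 < r -> 0 < eta ->
  exists2 d0, 0 < d0 & forall d, 0 <= d <= d0 -> exists s,
    [/\ 0 < s, `|1 - s| <= eta, `|1 - s^-1| <= eta &
    (s * r - s^-1 * r^-1) ^+ 2 = (r - r^-1) ^+ 2 + d].
Proof.
move=> r0 eta0.
have near1 s : 1 <= s <= 1 + eta ->
    [/\ 0 < s, `|1 - s| <= eta & `|1 - s^-1| <= eta].
  move=> /andP[s1 s2]; have s0 : 0 < s by lra.
  have sV : s^-1 <= 1 by rewrite invf_le1.
  split=> //; first by rewrite distrC ger0_norm; lra.
  rewrite ger0_norm; last by lra.
  apply: (@le_trans _ _ (s - 1)); last by lra.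
  have : 0 <= (s - 1) * (1 - s^-1) by rewrite mulr_ge0 ?subr_ge0.
  by rewrite mulrBl mulrBr mulrBr !mul1r mulr1 mulfV ?gt_eqF//; lra.
have [r1|r1] := lerP 1 r.
  have [d0 d0_gt0 H] := modulus_perturbation_ge1 r1 eta0.
  exists d0 => // d /H[s /near1[s0 s1 s2] sE]; exists s; split=> //.
  by rewrite -sE invfM.
(* For [r < 1] the previous case applies with [r] and [s] replaced by their inverses. *)
have rV1 : 1 <= r^-1 by rewrite invf_ge1// ltW.
have [d0 d0_gt0 H] := modulus_perturbation_ge1 rV1 eta0.
exists d0 => // d /H[s /near1[s0 s1 s2] sE]; exists s^-1.
rewrite invrK; split=> //; first by rewrite invr_gt0.
have -> : (r - r^-1) ^+ 2 = (r^-1 - r^-1^-1) ^+ 2 by rewrite invrK -sqrrN opprB.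
by rewrite -sE invfM invrK -sqrrN opprB.
Qed.

(** Multiplying the entry above the diagonal by [s j > 0] and its mirror image by the inverse keeps
    their product 1 and changes only the difference of the moduli. Where [P] fails, the increment is
    0. *)
Lemma reciprocal_perturbation n (A : 'M[C]_n.+1) (P : pred 'I_n) (e : R) :
    reciprocal A -> 0 < e ->
  exists2 d, 0 < d & exists2 A' : 'M[C]_n.+1, reciprocal A' &
    (forall i j, cmod (A i j - A' i j) <= e) /\
    (forall j, xi A' j = xi A j + d *+ P j).
Proof.
move=> hA e0.
pose a j := A (jl j) (jr j); pose b j := A (jr j) (jl j).
have ab j : a j * b j = 1 by exact: hA.2.
have cab j : cmod (a j) * cmod (b j) = 1.
  by rewrite -cmodM ab; exact: ComplexField.Normc.normc1.
have ca0 j : 0 < cmod (a j).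
  rewrite lt_def cmod_ge0 andbT; apply/eqP => a0.
  by have /eqP := cab j; rewrite a0 mul0r eq_sym oner_eq0.
have cbE j : cmod (b j) = (cmod (a j))^-1.
  by rewrite -[LHS]mul1r -(mulVf (lt0r_neq0 (ca0 j))) -mulrA cab mulr1.
have cb0 j : 0 < cmod (b j) by rewrite cbE invr_gt0.
have M_ex j : {d0 | 0 < d0 & forall d, 0 <= d <= d0 -> exists s,
    [/\ 0 < s, cmod (a j) * `|1 - s| <= e, cmod (b j) * `|1 - s^-1| <= e &
    (s * cmod (a j) - s^-1 * cmod (b j)) ^+ 2 =
    (cmod (a j) - cmod (b j)) ^+ 2 + d]}.
  apply: cid2.
  (* Relative changes of at most [eta] move both entries by at most [e]. *)
  pose eta := e / (cmod (a j) + cmod (b j)).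
  have ab0 : 0 < cmod (a j) + cmod (b j) by rewrite addr_gt0.
  have eta0 : 0 < eta by rewrite divr_gt0.
  have [d0 d00 H] := modulus_perturbation (ca0 j) eta0; exists d0 => // d /H[s].
  rewrite -cbE => -[s0 s1 s2 sE]; exists s; split=> //.
    apply: (le_trans (ler_wpM2l (cmod_ge0 _) s1)); rewrite /eta mulrA.
    by rewrite ler_pdivrMr// mulrC ler_pM2l// lerDl ltW.
  apply: (le_trans (ler_wpM2l (cmod_ge0 _) s2)); rewrite /eta mulrA.
  by rewrite ler_pdivrMr// mulrC ler_pM2l// lerDr ltW.
(* One increment reachable for every [j]; the initial value 1 covers [n = 0]. *)
pose d := \big[Num.min/1]_j s2val (M_ex j).
have d_gt0 : 0 < d.
  by apply/bigmin_gtP; split=> [|j _]; [|by case: (M_ex j)]; rewrite ltr01.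
have s_ex j : {s | [/\ 0 < s, cmod (a j) * `|1 - s| <= e,
    cmod (b j) * `|1 - s^-1| <= e & (s * cmod (a j) - s^-1 * cmod (b j)) ^+ 2 =
    (cmod (a j) - cmod (b j)) ^+ 2 + d *+ P j]}.
  apply: cid; apply: (s2valP' (M_ex j)).
  have dj : d <= s2val (M_ex j) by exact: bigmin_le.
  by case: (P j); rewrite ?mulr1n ?mulr0n ?lexx /= ?dj ?ltW//; case: (M_ex j).
pose s j := sval (s_ex j); pose S k := oapp s 1 (insub k).
have SE (j : 'I_n) : S j = s j by rewrite /S valK.
pose W (i j : nat) : R :=
  if j == i.+1 then S i else if i == j.+1 then (S j)^-1 else 1.
have jlE (j : 'I_n) : jl j = j :> nat by [].
have jrE (j : 'I_n) : jr j = j.+1 :> nat by [].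
have Wlr j : W (jl j) (jr j) = s j by rewrite /W jrE jlE eqxx SE.
have Wrl j : W (jr j) (jl j) = (s j)^-1.
  by rewrite /W jrE jlE eqxx SE; case: eqP => //; lia.
(* The division by 4 is the one in [xi]. *)
exists (d / 4); first by rewrite divr_gt0.
exists (\matrix_(i, j) (A i j * (W i j)%:C)).
  split=> [i j ji ij|j].
    by rewrite mxE hA.1// mul0r.
  rewrite !mxE Wlr Wrl mulrACA hA.2 mul1r -rmorphM mulfV//.
  by have [/lt0r_neq0] := svalP (s_ex j).
split=> [i j|j]; last first.
  rewrite /xi !mxE Wlr Wrl !cmodM.
  have [s0 _ _ sE] := svalP (s_ex j).
  rewrite !cmod_real_ge0 ?ltW ?invr_gt0// ![cmod _ * _]mulrC sE mulrDl.
  by rewrite -mulrnAl.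
rewrite mxE (_ : _ - _ = A i j * (1 - W i j)%:C); last first.
  by rewrite rmorphB rmorph1 mulrBr mulr1.
have cmod_real (x : R) : cmod x%:C = `|x| by rewrite /cmod /= expr0n addr0 sqrtr_sqr.
rewrite cmodM cmod_real /W.
case: eqP => [ji|_].
  have iln : (i < n)%N by rewrite -ltnS -ji.
  have -> : i = jl (Ordinal iln) by exact: val_inj.
  have -> : j = jr (Ordinal iln) by exact: val_inj.
  rewrite jlE SE; by have [] := svalP (s_ex (Ordinal iln)).
case: eqP => [ij|_].
  have jln : (j < n)%N by rewrite -ltnS -ij.
  have -> : j = jl (Ordinal jln) by exact: val_inj.
  have -> : i = jr (Ordinal jln) by exact: val_inj.
  rewrite jlE SE; by have [] := svalP (s_ex (Ordinal jln)).
by rewrite subrr normr0 mulr0 ltW.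
Qed.
End perturbation.

(** * The rank-2 numerical range as an intersection of two disks *)

Section rank2_range.
Variable R : realType.
Local Notation C := R[i].

(** At [t = Re(w z)] the disk conditions bound the factors by [b1 ^+ 2 - b1' ^+ 2] and
    [b2 ^+ 2 - b2' ^+ 2], both negative, so the determinant is nonzero. *)
Lemma mem_rank2_range_inner (A : 'M[C]_4) (m f1 b1 f2 b2 b1' b2' : R) (z : C) :
    reciprocal A ->
    (forall c t, kippenhahn_det A c t =
      ((t - m * c) ^+ 2 - (f1 ^+ 2 * c ^+ 2 + b1' ^+ 2)) *
      ((t + m * c) ^+ 2 - (f2 ^+ 2 * c ^+ 2 + b2' ^+ 2))) ->
    b1 ^+ 2 < b1' ^+ 2 -> b2 ^+ 2 < b2' ^+ 2 ->
    elliptical_disk (m + f1)%:C (m - f1)%:C b1 z ->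
    elliptical_disk (- m + f2)%:C (- m - f2)%:C b2 z ->
  rank_numerical_range 2 A z.
Proof.
move=> hA detE b1b b2b /elliptical_diskP D1 /elliptical_diskP D2.
apply: mem_rank_numerical_range => // w w1; rewrite detE mulf_neq0// lt_eqF//.
  by have := D1 _ w1; lra.
by have := D2 _ w1; rewrite mulNr opprK; lra.
Qed.

Section factorization.
Variables (A : 'M[C]_4) (m f1 b1 f2 b2 : R).
Hypothesis hA : reciprocal A.
Hypothesis detE : forall c t, kippenhahn_det A c t =
  ((t - m * c) ^+ 2 - (f1 ^+ 2 * c ^+ 2 + b1 ^+ 2)) *
  ((t + m * c) ^+ 2 - (f2 ^+ 2 * c ^+ 2 + b2 ^+ 2)).
Hypothesis inner_roots : forall c, `|2 * m * c| <=
  Num.sqrt (f1 ^+ 2 * c ^+ 2 + b1 ^+ 2) + Num.sqrt (f2 ^+ 2 * c ^+ 2 + b2 ^+ 2).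

Lemma rank2_range_sub :
  rank_numerical_range 2 A `<=`
  elliptical_disk (m + f1)%:C (m - f1)%:C b1 `&`
  elliptical_disk (- m + f2)%:C (- m - f2)%:C b2.
Proof.
have sqr_le (x y : R) :
    0 <= y -> x <= Num.sqrt y -> - x <= Num.sqrt y -> x ^+ 2 <= y.
  move=> y0 xy xy'; rewrite -[leRHS]sqr_sqrtr// -real_normK ?num_real//.
  by rewrite ler_pXn2r ?nnegrE ?sqrtr_ge0// ler_norml; apply/andP; split; lra.
have ReN (u : C) : complex.Re (- u) = - complex.Re u by case: u.
have pos (f b c : R) : 0 <= f ^+ 2 * c ^+ 2 + b ^+ 2.
  by rewrite addr_ge0 ?sqr_ge0// mulr_ge0 ?sqr_ge0.
move=> z zA; split; apply/elliptical_diskP => w w1.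
(* The half-planes for [w] and [- w] together bound an absolute value. *)
all: have w1' : cmod (- w) = 1 by case: w w1 => c s; rewrite /cmod /= !sqrrN.
all: have := rank_numerical_range_half_plane hA detE inner_roots zA w1.
all: have := rank_numerical_range_half_plane hA detE inner_roots zA w1'.
all: rewrite mulNr !ReN.
all: rewrite /= ?sqrrN => -[h1 h2] [h3 h4].
all: by apply: sqr_le => //; lra.
Qed.

(** [P] selects parameters whose common increase keeps the foci and strictly enlarges both minor
    half-axes, so that points of the closed disks become interior. *)
Lemma rank2_rangeE (P : pred 'I_3) :
    (forall d (A' : 'M[C]_4), 0 < d ->
      (forall j, xi A' j = xi A j + d *+ P j) -> exists b1' b2',
      [/\ b1 ^+ 2 < b1' ^+ 2, b2 ^+ 2 < b2' ^+ 2 &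
      forall c t, kippenhahn_det A' c t =
        ((t - m * c) ^+ 2 - (f1 ^+ 2 * c ^+ 2 + b1' ^+ 2)) *
        ((t + m * c) ^+ 2 - (f2 ^+ 2 * c ^+ 2 + b2' ^+ 2))]) ->
  rank_numerical_range 2 A =
  elliptical_disk (m + f1)%:C (m - f1)%:C b1 `&`
  elliptical_disk (- m + f2)%:C (- m - f2)%:C b2.
Proof.
move=> enlarge; apply/seteqP; split; first exact: rank2_range_sub.
move=> z [z1 z2]; apply: rank_numerical_range_limit => e e0.
have [d d0 [A' hA' [AA' xiE]]] := reciprocal_perturbation P hA e0.
have [b1' [b2' [lt1 lt2 detE']]] := enlarge d A' d0 xiE.
by exists A' => //; exact: mem_rank2_range_inner detE' lt1 lt2 z1 z2.
Qed.
End factorization.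
End rank2_range.

(** * The two golden-ratio families *)

Section golden_ratio.
Variable R : realType.
Local Notation C := R[i].
Local Notation phi := (golden R).

Lemma sqr_golden : phi ^+ 2 = phi + 1.
Proof.
have : Num.sqrt 5 ^+ 2 = 5 :> R by rewrite sqr_sqrtr.
by rewrite /golden; move: (Num.sqrt 5) => s ss; field: ss.
Qed.

Lemma golden_gt1 : 1 < phi.
Proof.
have := sqrtr_ge0 (5 : R); have := sqr_golden; rewrite /golden; nra.
Qed.

Lemma goldenV : phi^-1 = phi - 1.
Proof.
have phi0 : phi != 0 by rewrite gt_eqF// (lt_trans ltr01 golden_gt1).
apply: (mulfI phi0); rewrite mulfV// mulrBr -expr2 sqr_golden; ring.
Qed.

Lemma xi_ge0 n (A : 'M[C]_n.+1) j : 0 <= xi A j.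
Proof. by rewrite /xi divr_ge0 ?sqr_ge0. Qed.

(** The factors are [t^2 - phi^2 (c^2 + x1)] and [t^2 - phi^-2 (c^2 + x3)]; the coefficients agree
    because [phi^2 = 1 + phi], [phi^-2 = 1 - phi^-1] and [phi^2 + phi^-2 = 3]. *)
Lemma kippenhahn_det_golden (x1 x3 c t : R) : 0 <= x1 -> 0 <= x3 ->
  t ^+ 4 - (x1 + (phi * x1 - phi^-1 * x3) + x3 + 3 * c ^+ 2) * t ^+ 2 +
    (x1 + c ^+ 2) * (x3 + c ^+ 2) =
  ((t - 0 * c) ^+ 2 - (phi ^+ 2 * c ^+ 2 + (Num.sqrt x1 * phi) ^+ 2)) *
  ((t + 0 * c) ^+ 2 - (phi^-1 ^+ 2 * c ^+ 2 + (Num.sqrt x3 * phi^-1) ^+ 2)).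
Proof.
move=> x1_ge0 x3_ge0; rewrite goldenV; have := sqr_golden; move: phi => p pp.
rewrite ![(Num.sqrt _ * _) ^+ 2]exprMn !sqr_sqrtr//.
have p1 : (p - 1) ^+ 2 = 2 - p by rewrite sqrrB pp; ring.
rewrite p1 !pp.
apply/eqP; rewrite -subr_eq0; apply/eqP.
transitivity ((p ^+ 2 - (p + 1)) * (c ^+ 2 + x1) * (c ^+ 2 + x3)); last first.
  by rewrite pp subrr !mul0r.
ring.
Qed.

(** The determinant is symmetric in the first and third parameters, so [x1] and [x3] may be either
    assignment of them. *)
Lemma rank2_range_golden (A : 'M[C]_4) (x1 x3 : R) : reciprocal A ->
    x1 = xi A (@Ordinal 3 0 isT) /\ x3 = xi A (@Ordinal 3 2 isT) \/
    x1 = xi A (@Ordinal 3 2 isT) /\ x3 = xi A (@Ordinal 3 0 isT) ->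
    xi A (@Ordinal 3 1 isT) = phi * x1 - phi^-1 * x3 ->
  rank_numerical_range 2 A =
    elliptical_disk (phi^-1)%:C (- (phi^-1)%:C) (Num.sqrt x3 * phi^-1) /\
  inner_component A (phi^-1)%:C (Num.sqrt x3 * phi^-1).
Proof.
move=> hA x13 x2E.
have x1_ge0 : 0 <= x1 by case: x13 => -[-> _]; exact: xi_ge0.
have x3_ge0 : 0 <= x3 by case: x13 => -[_ ->]; exact: xi_ge0.
have det_gold (d : R) (A' : 'M[C]_4) : 0 <= d -> (forall j, xi A' j = xi A j + d) ->
    forall c t, kippenhahn_det A' c t =
  ((t - 0 * c) ^+ 2 - (phi ^+ 2 * c ^+ 2 + (Num.sqrt (x1 + d) * phi) ^+ 2)) *
  ((t + 0 * c) ^+ 2 -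
    (phi^-1 ^+ 2 * c ^+ 2 + (Num.sqrt (x3 + d) * phi^-1) ^+ 2)).
  move=> d0 xiE c t.
  rewrite -kippenhahn_det_golden ?addr_ge0// /kippenhahn_det !xiE x2E.
  (* As [phi - phi^-1 = 1], raising all parameters by [d] preserves the linear relation. *)
  have -> : phi * (x1 + d) - phi^-1 * (x3 + d) = phi * x1 - phi^-1 * x3 + d.
    rewrite goldenV; ring.
  by case: x13 => -[<- <-]; ring.
have detE := det_gold 0 A (lexx 0) (fun j => esym (addr0 (xi A j))).
rewrite !addr0 in detE.
have phi1 := golden_gt1.
have psi0 : 0 < phi^-1 by rewrite invr_gt0 (lt_trans ltr01).
(* Nonnegativity of the middle parameter is what nests the ellipses. *)
have x3_le : x3 <= phi ^+ 2 * x1.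
  have := xi_ge0 A (@Ordinal 3 1 isT); rewrite x2E subr_ge0 mulrC.
  rewrite ler_pdivrMr ?(lt_trans ltr01)//.
  by rewrite mulrAC -expr2.
have disk_lt : elliptical_disk (0 + phi^-1)%:C (0 - phi^-1)%:C (Num.sqrt x3 * phi^-1)
    `<` elliptical_disk (0 + phi)%:C (0 - phi)%:C (Num.sqrt x1 * phi).
  have psi1 : phi^-1 ^+ 2 < 1.
    by rewrite exprn_ilt1// ?ltW// invf_lt1// (lt_trans ltr01).
  have phi_sq1 : 1 < phi ^+ 2 by rewrite exprn_egt1.
  have phix1 : 0 <= phi ^+ 2 * x1 by rewrite mulr_ge0 ?sqr_ge0.
  have psix3 : phi^-1 ^+ 2 * x3 <= x3 by rewrite ler_piMl// ltW.
  have b1E : (Num.sqrt x1 * phi) ^+ 2 = phi ^+ 2 * x1.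
    by rewrite exprMn sqr_sqrtr// mulrC.
  have b2E : (Num.sqrt x3 * phi^-1) ^+ 2 = phi^-1 ^+ 2 * x3.
    by rewrite exprMn sqr_sqrtr// mulrC.
  split=> [z /elliptical_diskP zin|sub].
    apply/elliptical_diskP => w w1; apply: le_trans (zin w w1) _.
    rewrite b1E b2E lerD//; last by lra.
    by rewrite ler_wpM2r ?sqr_ge0//; lra.
  (* [v] is the vertex of the outer ellipse on the real axis; the direction [w = 1] separates it
     from the inner disk. *)
  pose v := Num.sqrt (phi ^+ 2 + phi ^+ 2 * x1).
  have vE : v ^+ 2 = phi ^+ 2 + phi ^+ 2 * x1 by rewrite sqr_sqrtr//; lra.
  have /sub/elliptical_diskP : elliptical_disk (0 + phi)%:C (0 - phi)%:C
      (Num.sqrt x1 * phi) v%:C.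
    apply/elliptical_diskP => w w1; rewrite b1E mul0r subr0.
    have -> : complex.Re (w * v%:C) = complex.Re w * v.
      by case: (w) => ? ? /=; rewrite mulr0 subr0.
    have := sqr_cmodE w; rewrite w1 expr1n => cs; rewrite exprMn vE mulrDr.
    rewrite [complex.Re w ^+ 2 * _]mulrC lerD2l ler_piMl//.
    by rewrite cs lerDl sqr_ge0.
  move=> /(_ 1 (ComplexField.Normc.normc1 R)).
  rewrite b2E mul1r /= mul0r subr0 vE expr1n mulr1; lra.
have inner0 (c : R) : `|2 * 0 * c| <=
    Num.sqrt (phi ^+ 2 * c ^+ 2 + (Num.sqrt x1 * phi) ^+ 2) +
    Num.sqrt (phi^-1 ^+ 2 * c ^+ 2 + (Num.sqrt x3 * phi^-1) ^+ 2).
  by rewrite mulr0 mul0r normr0 addr_ge0 ?sqrtr_ge0.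
split; last first.
  exists phi%:C, (Num.sqrt x1 * phi); split.
  - by rewrite mulr_ge0 ?sqrtr_ge0// ltW// (lt_trans ltr01).
  - by rewrite (kippenhahn_curve_ellipses hA detE) oppr0 !add0r !rmorphN.
  - by move: disk_lt; rewrite !add0r !rmorphN.
rewrite (rank2_rangeE hA detE inner0 (P := predT)) => [|d A' d0 xiE].
  by move: disk_lt.1; rewrite oppr0 !add0r !rmorphN => /setIidr.
exists (Num.sqrt (x1 + d) * phi), (Num.sqrt (x3 + d) * phi^-1).
split; last exact: det_gold (ltW d0) _.
- rewrite ![(Num.sqrt _ * _) ^+ 2]exprMn !sqr_sqrtr ?addr_ge0 ?(ltW d0)//.
  by rewrite ltr_pM2r ?ltrDl// exprn_gt0// (lt_trans ltr01).
- rewrite ![(Num.sqrt _ * _) ^+ 2]exprMn !sqr_sqrtr ?addr_ge0 ?(ltW d0)//.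
  by rewrite ltr_pM2r ?ltrDl// exprn_gt0.
Qed.

(** The centres are [1/2] and [-1/2], and the square of the half focal distance is [5/4]. The
    product is then [(t^2 - c^2 - x)^2 - c^2 t^2]. *)
Lemma kippenhahn_det_symmetric (x c t : R) : 0 <= x ->
  t ^+ 4 - (x + 0 + x + 3 * c ^+ 2) * t ^+ 2 + (x + c ^+ 2) * (x + c ^+ 2) =
  ((t - 2^-1 * c) ^+ 2 - ((phi - 2^-1) ^+ 2 * c ^+ 2 + Num.sqrt x ^+ 2)) *
  ((t + 2^-1 * c) ^+ 2 - ((2^-1 - phi) ^+ 2 * c ^+ 2 + Num.sqrt x ^+ 2)).
Proof.
move=> x0; rewrite !sqr_sqrtr// -(opprB phi) sqrrN.
have -> : (phi - 2^-1) ^+ 2 = 5 / 4 by rewrite sqrrB sqr_golden; field.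
by field.
Qed.

Lemma rank2_range_symmetric (A : 'M[C]_4) (x : R) : reciprocal A ->
    x = xi A (@Ordinal 3 0 isT) -> xi A (@Ordinal 3 1 isT) = 0 ->
    x = xi A (@Ordinal 3 2 isT) ->
  rank_numerical_range 2 A =
    elliptical_disk phi%:C (- (phi^-1)%:C) (Num.sqrt x) `&`
    elliptical_disk (- phi%:C) (phi^-1)%:C (Num.sqrt x) /\
  kippenhahn_curve A =
    ellipse phi%:C (- (phi^-1)%:C) (Num.sqrt x) `|`
    ellipse (- phi%:C) (phi^-1)%:C (Num.sqrt x).
Proof.
move=> hA x1E x2E x3E.
have x_ge0 : 0 <= x by rewrite x1E xi_ge0.
have f1E : 2^-1 + (phi - 2^-1) = phi by ring.
have f2E : 2^-1 - (phi - 2^-1) = - phi^-1 by rewrite goldenV; field.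
have f3E : - 2^-1 + (2^-1 - phi) = - phi by ring.
have f4E : - 2^-1 - (2^-1 - phi) = phi^-1 by rewrite goldenV; field.
have detE c t : kippenhahn_det A c t =
  ((t - 2^-1 * c) ^+ 2 - ((phi - 2^-1) ^+ 2 * c ^+ 2 + Num.sqrt x ^+ 2)) *
  ((t + 2^-1 * c) ^+ 2 - ((2^-1 - phi) ^+ 2 * c ^+ 2 + Num.sqrt x ^+ 2)).
  by rewrite -kippenhahn_det_symmetric// /kippenhahn_det -x1E -x3E x2E.
have inner_roots (c : R) : `|2 * 2^-1 * c| <=
    Num.sqrt ((phi - 2^-1) ^+ 2 * c ^+ 2 + Num.sqrt x ^+ 2) +
    Num.sqrt ((2^-1 - phi) ^+ 2 * c ^+ 2 + Num.sqrt x ^+ 2).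
  rewrite mulfV ?pnatr_eq0// mul1r -(opprB phi) sqrrN.
  have phi2 : 1 / 4 <= (phi - 2^-1) ^+ 2.
    have -> : (phi - 2^-1) ^+ 2 = 5 / 4 by rewrite sqrrB sqr_golden; field.
    by lra.
  have c_le : `|c| / 2 <= Num.sqrt ((phi - 2^-1) ^+ 2 * c ^+ 2 + Num.sqrt x ^+ 2).
    have -> : `|c| / 2 = Num.sqrt (c ^+ 2 / 4).
      rewrite (_ : c ^+ 2 / 4 = (c / 2) ^+ 2); last by field.
      by rewrite sqrtr_sqr normrM [X in _ = _ * X]ger0_norm.
    rewrite ler_wsqrtr//; have := sqr_ge0 (Num.sqrt x).
    by have := ler_wpM2r (sqr_ge0 c) phi2; lra.
  by lra.
split; last first.
  by rewrite (kippenhahn_curve_ellipses hA detE) f1E f2E f3E f4E !rmorphN.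
(* Only the outer parameters are increased, since the factorization needs the middle one to stay
   0. *)
rewrite (rank2_rangeE hA detE inner_roots (P := [pred j | j != @Ordinal 3 1 isT])).
  by rewrite f1E f2E f3E f4E !rmorphN.
move=> d A' d0 xiE; exists (Num.sqrt (x + d)), (Num.sqrt (x + d)).
split; [by rewrite !sqr_sqrtr ?addr_ge0 ?(ltW d0) ?ltrDl//..|].
move=> c t; rewrite -kippenhahn_det_symmetric ?addr_ge0 ?(ltW d0)//.
by rewrite /kippenhahn_det !xiE -x1E -x3E x2E /= !mulr1n mulr0n addr0.
Qed.
End golden_ratio.


Theorem corollary4 (R : realType) (A : 'M[R[i]]_4) (hA : reciprocal A)
    (xi1 xi2 xi3 : R)
    (h1 : xi1 = xi A (@Ordinal 3 0 isT))
    (h2 : xi2 = xi A (@Ordinal 3 1 isT))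
    (h3 : xi3 = xi A (@Ordinal 3 2 isT))
    (phi : R) (hphi : phi = golden R) :
  [/\ (xi2 = phi * xi1 - phi^-1 * xi3 ->
         rank_numerical_range 2 A =
           elliptical_disk (phi^-1)%:C (- (phi^-1)%:C) (Num.sqrt xi3 * phi^-1)
         /\ inner_component A (phi^-1)%:C (Num.sqrt xi3 * phi^-1)),
      (xi2 = phi * xi3 - phi^-1 * xi1 ->
         rank_numerical_range 2 A =
           elliptical_disk (phi^-1)%:C (- (phi^-1)%:C) (Num.sqrt xi1 * phi^-1)
         /\ inner_component A (phi^-1)%:C (Num.sqrt xi1 * phi^-1)) &
      (xi2 = 0 -> xi1 = xi3 -> xi3 != 0 ->
         rank_numerical_range 2 A =
           elliptical_disk phi%:C (- (phi^-1)%:C) (Num.sqrt xi1) `&`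
           elliptical_disk (- phi%:C) (phi^-1)%:C (Num.sqrt xi1)
         /\ kippenhahn_curve A =
           ellipse phi%:C (- (phi^-1)%:C) (Num.sqrt xi1) `|`
           ellipse (- phi%:C) (phi^-1)%:C (Num.sqrt xi1))].
Proof.
subst phi; split.
- by rewrite h1 h2 h3; apply: rank2_range_golden => //; left.
- by rewrite h1 h2 h3; apply: rank2_range_golden => //; right.
- move=> x2 x13 _; rewrite x13; apply: rank2_range_symmetric => //.
  + by rewrite -x13 h1.
  + by rewrite -h2.
Qed.
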